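(* The free $\mathbb{Q}(r,s)$-module $H_{r,s}(A_\infty)$ with the multiplication $$u_\alpha u_\beta=\sum_{\lambda\in\mathcal{P}}s^{-\langle\alpha,\beta\rangle}F^{\lambda}_{\alpha\beta}(rs^{-1})\,u_\lambda\qquad(\alpha,\beta\in\mathcal{P})$$ is an associative $\mathbb{Q}(r,s)$-algebra. For all $m\ge n\ge1$, the algebra $H_{r,s}(A_n)$ can be regarded as a subalgebra of $H_{r,s}(A_\infty)$ and of $H_{r,s}(A_m)$. In particular, $$H_{r,s}(A_\infty)=\varinjlim_{n}H_{r,s}(A_n).$$
   Context: $\mathbb{Q}(r,s)$ is the field of rational functions in two independent variables $r,s$. $A_\infty$ is the infinite linear quiver $1\to2\to3\to\cdots$, and $A_n$ its full subquiver $1\to2\to\cdots\to n$. Representations are finite dimensional over a field $k$; representations of $A_n$ are regarded as representations of $A_m$ ($m\ge n$) and of $A_\infty$ by extension by zero. For $i\le j$ let $M_{ij}$ be the indecomposable representation with top the simple $S_i$ and length $j-i+1$ (composition factors $S_i,\dots,S_j$), corresponding to the positive root $\alpha_{ij}=\alpha_i+\dots+\alpha_j$; $\Phi^+$ is the set of these roots. The set $\mathcal{P}$ of isomorphism classes of finite dimensional representations of $A_\infty$ is identified, independently of $k$, with the finitely supported maps $\lambda:\Phi^+\to\mathbb{Z}_{\ge0}$, via $M_k(\lambda)=\bigoplus_{a\in\Phi^+}\lambda(a)M_k(a)$. For $\alpha,\beta\in\mathcal{P}$, $\langle\alpha,\beta\rangle=\dim_k\mathrm{Hom}(M_k(\alpha),M_k(\beta))-\dim_k\mathrm{Ext}^1(M_k(\alpha),M_k(\beta))$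 (depends only on dimension vectors). $F^\lambda_{\alpha\beta}(x)\in\mathbb{Z}[x]$ is the Hall polynomial: for every finite field $k$ with $q$ elements, $F^\lambda_{\alpha\beta}(q)$ is the number of subrepresentations $N$ of $M_k(\lambda)$ with $N\cong M_k(\beta)$ and $M_k(\lambda)/N\cong M_k(\alpha)$. $H_{r,s}(A_\infty)$ is the free $\mathbb{Q}(r,s)$-module with basis $\{u_\alpha\mid\alpha\in\mathcal{P}\}$. $H_{r,s}(A_n)$ is defined by the same recipe from the isomorphism classes of finite dimensional representations of $A_n$. *)

(* Defs.v *)
From HB Require Import structures.
From mathcomp Require Import all_boot all_order all_algebra.
From mathcomp Require Import fraction mxrepresentation.
From mathcomp Require Import finmap.
From mathcomp Require Import mathcomp_extra boolp classical_sets functions.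
From mathcomp Require Import cardinality fsbigop.
From mathcomp Require Import freeg.

Set Implicit Arguments.
Unset Strict Implicit.
Unset Printing Implicit Defensive.

Import GRing.Theory.

Local Open Scope classical_set_scope.
Local Open Scope card_scope.
Local Open Scope ring_scope.

(* Vertices are the positive integers, with one arrow t -> t.+1. *)
Variant quiver := An of nat | Ainf.

Definition vertex (Q : quiver) (t : nat) : bool :=
  (0 < t)%N && (if Q is An n then (t <= n)%N else true).

(* The pair (i, j) stands for the root alpha_i + ... + alpha_j. *)
Definition proot (Q : quiver) : Type :=
  {ij : nat * nat | vertex Q ij.1 && vertex Q ij.2 && (ij.1 <= ij.2)%N}.

Definition isoclass (Q : quiver) : Type := {fsfun proot Q -> nat with 0%N}.

(* Matrices act on row vectors from the right, so a composite "first f, then g"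
   is f *m g, a monomorphism is row_free, an epimorphism is row_full. Spaces are
   indexed by all natural numbers and vanish off the vertices: extension by
   zero thus changes neither the spaces nor the maps. *)
Record rep (k : fieldType) (Q : quiver) := Rep {
  rdim :> nat -> nat;
  arrow : forall t, 'M[k]_(rdim t, rdim t.+1);
  rdim_vertex : forall t, ~~ vertex Q t -> rdim t = 0%N;
  rdim_finite : exists n, forall t, (n <= t)%N -> rdim t = 0%N
}.

Section Representations.
Variables (k : fieldType) (Q : quiver).
Implicit Types V W : rep k Q.

Definition graded_map V W := forall t, 'M[k]_(V t, W t).

Definition hom V W : set (graded_map V W) :=
  [set h | forall t, arrow V t *m h t.+1 = h t *m arrow W t].

Definition isomorphic V W : Prop :=
  exists h : graded_map V W, exists g : graded_map W V,
    [/\ hom h, hom g, forall t, h t *m g t = 1%:M & forall t, g t *m h t = 1%:M].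

Definition mono V W (h : graded_map V W) : Prop :=
  hom h /\ forall t, row_free (h t).

Definition short_exact V I C (f : graded_map V I) (g : graded_map I C) : Prop :=
  [/\ mono f, hom g, forall t, row_full (g t)
    & forall t, (f t :=: kermx (g t))%MS].

Definition injective_rep I : Prop :=
  forall V W (f : graded_map V W) (g : graded_map V I), mono f -> hom g ->
  exists2 h : graded_map W I, hom h & forall t, f t *m h t = g t.

(* dim_k (S / T) = d, for subspaces T `<=` S of families of matrices *)
Definition has_dim V W (S T : set (graded_map V W)) (d : nat) : Prop :=
  exists b : 'I_d -> graded_map V W, (forall j, S (b j)) /\
    forall h, S h -> exists! c : 'rV[k]_d,
      T (fun t => h t - \sum_j c 0 j *: b j t).

Definition dim_hom V W : nat :=
  xget 0%N [set d | has_dim (@hom V W) [set h | forall t, h t = 0] d].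

(* Ext^1(V, W) is the cokernel of Hom(V, I) -> Hom(V, C) for a short exact
   sequence 0 -> W -> I -> C -> 0 with I injective. Injectives are used rather
   than projectives because the projective covers over A_infinity are infinite
   dimensional, whereas the injective hull of the simple at j is the interval
   module with factors 1, ..., j. *)
Definition dim_ext1 V W : nat :=
  xget 0%N [set d | exists I C : rep k Q,
    exists f : graded_map W I, exists g : graded_map I C,
    [/\ injective_rep I, short_exact f g
      & has_dim (@hom V C)
          [set h | exists2 l, @hom V I l & forall t, h t = l t *m g t] d]].

Lemma zero_rep_subproof t : ~~ vertex Q t -> (fun=> 0%N) t = 0%N :> nat.
Proof. by []. Qed.

Lemma zero_rep_finite : exists n, forall t, (n <= t)%N -> 0%N = 0%N :> nat.
Proof. by exists 0%N. Qed.

Definition zero_rep : rep k Q :=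
  @Rep k Q (fun=> 0%N) (fun=> 0) zero_rep_subproof zero_rep_finite.

Section DirectSum.
Variables V W : rep k Q.

Lemma dsum_vertex t : ~~ vertex Q t -> (V t + W t)%N = 0%N.
Proof. by move=> h; rewrite !rdim_vertex. Qed.

Lemma dsum_finite : exists n, forall t, (n <= t)%N -> (V t + W t)%N = 0%N.
Proof.
have [[n hn] [m hm]] := (rdim_finite V, rdim_finite W).
by exists (maxn n m) => t; rewrite geq_max => /andP[/hn -> /hm ->].
Qed.

Definition dsum : rep k Q :=
  @Rep k Q (fun t => V t + W t)%N
    (fun t => block_mx (arrow V t) 0 0 (arrow W t)) dsum_vertex dsum_finite.
End DirectSum.

Section Interval.
Variable a : proot Q.

Let d t : nat := ((val a).1 <= t <= (val a).2)%N.

Lemma interval_vertex t : ~~ vertex Q t -> d t = 0%N.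
Proof.
rewrite /d; case: a => -[i j] /= /andP[/andP[]].
rewrite /vertex; case: Q => [n|] /andP[i0 Hi] /andP[j0 Hj] ij;
  case: (posnP t) => [->|t0]; rewrite ?(leqNgt i) ?i0 //= => H.
by rewrite andbC leqNgt (leq_ltn_trans Hj) // ltnNge.
Qed.

Lemma interval_finite : exists n, forall t, (n <= t)%N -> d t = 0%N.
Proof.
exists (val a).2.+1 => t; rewrite /d => ht.
by rewrite (leqNgt t) ht andbF.
Qed.

(* Both spaces have dimension at most 1, so const_mx 1 is the identity of k
   when neither of them is zero. *)
Definition interval_rep : rep k Q :=
  @Rep k Q d (fun=> const_mx 1) interval_vertex interval_finite.
End Interval.

Definition mod_of (l : isoclass Q) : rep k Q :=
  foldr dsum zero_rep
    (flatten [seq nseq (l a) (interval_rep a) | a <- finsupp l]).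

Definition euler (a b : isoclass Q) : int :=
  (dim_hom (mod_of a) (mod_of b))%:Z - (dim_ext1 (mod_of a) (mod_of b))%:Z.

Section SubQuotient.
Variable V : rep k Q.

(* A family of subspaces is given by square matrices with these row spaces. *)
Variable U : forall t, 'M[k]_(V t).

Definition is_subrep : Prop := forall t, (U t *m arrow V t <= U t.+1)%MS.

Lemma sub_vertex t : ~~ vertex Q t -> \rank (U t) = 0%N.
Proof.
move=> /(@rdim_vertex _ _ V) h.
by apply/eqP; rewrite -leqn0 -[X in (_ <= X)%N]h rank_leq_row.
Qed.

Lemma sub_finite : exists n, forall t, (n <= t)%N -> \rank (U t) = 0%N.
Proof.
have [n hn] := rdim_finite V; exists n => t /hn h.
by apply/eqP; rewrite -leqn0 -[X in (_ <= X)%N]h rank_leq_row.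
Qed.

Definition sub_rep : rep k Q :=
  @Rep k Q (fun t => \rank (U t))
    (fun t => in_submod (U t.+1) (val_submod (1%:M : 'M_(\rank (U t))) *m arrow V t))
    sub_vertex sub_finite.

Lemma quot_vertex t : ~~ vertex Q t -> \rank (cokermx (U t)) = 0%N.
Proof.
move=> /(@rdim_vertex _ _ V) h.
by apply/eqP; rewrite -leqn0 -[X in (_ <= X)%N]h rank_leq_row.
Qed.

Lemma quot_finite :
  exists n, forall t, (n <= t)%N -> \rank (cokermx (U t)) = 0%N.
Proof.
have [n hn] := rdim_finite V; exists n => t /hn h.
by apply/eqP; rewrite -leqn0 -[X in (_ <= X)%N]h rank_leq_row.
Qed.

Definition quot_rep : rep k Q :=
  @Rep k Q (fun t => \rank (cokermx (U t)))
    (fun t => in_factmod (U t.+1)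
       (val_factmod (1%:M : 'M_(\rank (cokermx (U t)))) *m arrow V t))
    quot_vertex quot_finite.
End SubQuotient.

(* The condition <<U t>> = U t selects one matrix for each subspace. *)
Definition hall_set (a b l : isoclass Q) :
    set (forall t, 'M[k]_(mod_of l t)) :=
  [set U | [/\ forall t, <<U t>>%MS = U t, is_subrep U,
     isomorphic (sub_rep U) (mod_of b) & isomorphic (quot_rep U) (mod_of a)]].
End Representations.

Definition hall_polynomial Q (a b l : isoclass Q) (f : {poly int}) : Prop :=
  forall k : finFieldType,
    exists2 n : nat, @hall_set k Q a b l #= `I_n & f.[#|k|%:Z] = n%:Z.

(* Q(r, s), as the fraction field of Q[r][s] *)
Notation Qrs := {fraction {poly {poly rat}}}.
Definition rvar : Qrs := tofrac ('X%:P).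
Definition svar : Qrs := tofrac 'X.

Definition Hrs (Q : quiver) : Type := {freeg (isoclass Q) / Qrs}.

Definition u Q (a : isoclass Q) : Hrs Q := << a >>.

Definition hone Q : Hrs Q := u [fsfun].

Section Multiplication.
Variables (k : fieldType) (Q : quiver).
Variable F : isoclass Q -> isoclass Q -> isoclass Q -> {poly int}.

Definition hcoef (a b l : isoclass Q) : Qrs :=
  svar ^ (- euler k a b) * (map_poly intr (F a b l)).[rvar * svar^-1].

Definition umul (a b : isoclass Q) : Hrs Q :=
  \sum_(l \in [set: isoclass Q]) (hcoef a b l *: u l).

(* bilinear extension of umul *)
Definition hmul (x y : Hrs Q) : Hrs Q :=
  fglift (fun a => fglift (fun b => umul a b) y) x.
End Multiplication.

(* extension by zero of a multiplicity function along the inclusion of roots *)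
Definition extend Q Q' (a : isoclass Q) : isoclass Q' :=
  [fsfun c in [fset c in pmap insub [seq val b | b <- finsupp a]]%fset
     => odflt 0%N (omap a (insub (val c)))].

Definition incl Q Q' : Hrs Q -> Hrs Q' := fglift (fun a => u (extend Q' a)).

Definition is_algebra (K : fieldType) (V : lmodType K)
    (mul : V -> V -> V) (one : V) : Prop :=
  [/\ forall y, linear (mul^~ y), forall x, linear (mul x), associative mul,
      left_id one mul & right_id one mul].

Definition is_alg_hom (K : fieldType) (V W : lmodType K)
    (mulV : V -> V -> V) (oneV : V) (mulW : W -> W -> W) (oneW : W)
    (f : V -> W) : Prop :=
  [/\ linear f, {morph f : x y / mulV x y >-> mulW x y} & f oneV = oneW].

(* Main.v *)
(** Over a field with q elements, F^l_ab(q) counts the subrepresentations of M(l)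
    isomorphic to M(b) with quotient isomorphic to M(a). The filtrations
    0 <= U1 <= U2 <= M(m) with factors M(c), M(b), M(a) can be counted by first
    choosing U1 (then U2 / U1 in M(m) / U1) or by first choosing U2 (then U1 in
    U2); since every representation is isomorphic to exactly one M(l), this gives
      sum_l F^l_ab F^m_lc = sum_l F^l_bc F^m_al
    at every prime q, hence as an identity of polynomials. The twist by the
    Euler form preserves associativity because <a,b> is the bilinear expression
    sum_t (a_t b_t - a_t b_(t+1)) in the dimension vectors: if I is injective,
    the map h |-> (h_t I_t - V_t h_(t+1))_t from the graded maps V_t -> I_t to
    the graded maps V_t -> I_(t+1), whose kernel is Hom(V, I), is onto, and
    likewise for quotients of I, so that a dimension count along an injective
    resolution computes dim Hom - dim Ext^1. Neither Hall numbers nor the Euler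
    form change under extension by zero, the middle term of an extension is
    supported where its factors are, and each basis element of H(A_infinity)
    already lives over some A_n. *)

From HB Require Import structures.
From mathcomp Require Import all_boot all_order all_algebra.
From mathcomp Require Import vector fraction mxrepresentation.
From mathcomp Require Import finmap.
From mathcomp Require Import boolp classical_sets functions.
From mathcomp Require Import cardinality fsbigop.
From mathcomp Require Import freeg zify.
Require Import Defs.

Set Implicit Arguments.
Unset Strict Implicit.
Unset Printing Implicit Defensive.

Import GRing.Theory.

Local Open Scope classical_set_scope.
Local Open Scope card_scope.
Local Open Scope ring_scope.

(** * Subquotients *)

Section Subquotients.
Variables (k : fieldType) (Q : quiver).
Implicit Types V W A B C L : rep k Q.

Lemma isomorphic_refl V : isomorphic V V.
Proof.
by exists (fun=> 1%:M), (fun=> 1%:M); split=> t; rewrite /= ?mulmx1 ?mul1mx.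
Qed.

Lemma isomorphic_sym V W : isomorphic V W -> isomorphic W V.
Proof. by case=> h [g [hh hg hK gK]]; exists g, h. Qed.

Lemma isomorphic_trans V W L :
  isomorphic V W -> isomorphic W L -> isomorphic V L.
Proof.
case=> h [g [hh hg hK gK]] [h' [g' [hh' hg' hK' gK']]].
exists (fun t => h t *m h' t), (fun t => g' t *m g t); split=> t /=.
- by rewrite mulmxA hh -!mulmxA hh'.
- by rewrite mulmxA hg' -!mulmxA hg.
- by rewrite mulmxA -(mulmxA (h t)) hK' mulmx1 hK.
- by rewrite mulmxA -(mulmxA (g' t)) gK mulmx1 gK'.
Qed.

Lemma isomorphic_dim V W : isomorphic V W -> forall t, V t = W t.
Proof.
case=> h [g [_ _ hK gK]] t; apply/eqP; rewrite eqn_leq; apply/andP; split.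
  by rewrite -(mxrank1 k (V t)) -hK (leq_trans (mxrankM_maxl _ _)) ?rank_leq_col.
by rewrite -(mxrank1 k (W t)) -gK (leq_trans (mxrankM_maxl _ _)) ?rank_leq_col.
Qed.

Definition family V := forall t, 'M[k]_(V t).

(* The maps [p t] induce an isomorphism from [U' / U] to [B]; their values
   outside of [U'] are irrelevant. *)
Definition subquotient_map V (U U' : family V) B (p : graded_map V B) : Prop :=
  [/\ is_subrep U',
      forall t, U' t *m arrow V t *m p t.+1 = U' t *m p t *m arrow B t,
      forall t, row_full (U' t *m p t)
    & forall t, (U' t :&: kermx (p t) :=: U t)%MS].

Definition subquotient V U U' B : Prop :=
  exists p, @subquotient_map V U U' B p.

Section SubquotientMap.
Variables (V : rep k Q) (U U' : family V) (B : rep k Q) (p : graded_map V B).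
Hypothesis pP : subquotient_map U U' p.

Lemma subquotient_stable m t (X : 'M_(m, V t)) :
  (X <= U' t)%MS -> (X *m arrow V t <= U' t.+1)%MS.
Proof. by case: pP => st _ _ _ /submxMr XU; rewrite (submx_trans (XU _ _)). Qed.

Lemma subquotient_hom m t (X : 'M_(m, V t)) :
  (X <= U' t)%MS -> X *m arrow V t *m p t.+1 = X *m p t *m arrow B t.
Proof.
by case: pP => _ hom _ _ /submxP[D ->]; rewrite -!mulmxA [U' t *m (_ *m _)]mulmxA
  hom -!mulmxA.
Qed.

Lemma subquotient_ker m t (X : 'M_(m, V t)) :
  (X <= U t)%MS = (X <= U' t)%MS && (X *m p t == 0).
Proof. by case: pP => _ _ _ ker; rewrite -ker sub_capmx -sub_kermx. Qed.

Lemma subquotient_subset t : (U t <= U' t)%MS.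
Proof. by have := submx_refl (U t); rewrite subquotient_ker => /andP[]. Qed.

Lemma subquotient_ker0 m t (X : 'M_(m, V t)) : (X <= U t)%MS -> X *m p t = 0.
Proof. by rewrite subquotient_ker => /andP[_ /eqP]. Qed.

(** The section is chosen vertex by vertex and need not commute with the arrows. It inverts [p]
    modulo [U], which suffices for transporting subspaces that contain [U]. *)
Lemma subquotient_section : exists s : graded_map B V,
  forall t, (s t <= U' t)%MS /\ s t *m p t = 1%:M.
Proof.
exists (fun t => pinvmx (U' t *m p t) *m U' t) => t; split; first exact: submxMl.
by case: pP => _ _ full _; rewrite -mulmxA mulVpmx.
Qed.

(** The order-reflecting half of the correspondence of subspaces: a vector of [X] and one of [Y]
    with the same image differ by an element of [U], which lies in [Y]. *)
Lemma subquotient_le m1 m2 t (X : 'M_(m1, V t)) (Y : 'M_(m2, V t)) :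
  (U t <= Y)%MS -> (X <= U' t)%MS -> (Y <= U' t)%MS ->
  (X *m p t <= Y *m p t)%MS -> (X <= Y)%MS.
Proof.
move=> UY XU' YU' /submxP[D eqXY].
have ->: X = D *m Y + (X - D *m Y) by rewrite addrC subrK.
apply/addmx_sub; first exact: submxMl.
apply: (submx_trans _ UY); rewrite subquotient_ker mulmxBl eqXY mulmxA subrr eqxx.
by rewrite addmx_sub // eqmx_opp mulmx_sub.
Qed.

Lemma subquotient_dim t : (\rank (U t) + B t)%N = \rank (U' t).
Proof.
case: pP => _ _ full ker; rewrite -ker.
by have /eqP := full t; rewrite -(mxrank_mul_ker (U' t) (p t)) addnC => ->.
Qed.

End SubquotientMap.

Lemma subquotient_subrepl V (U U' : family V) B (p : graded_map V B) :
  subquotient_map U U' p -> is_subrep U.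
Proof.
move=> pP t; have UU' := subquotient_subset pP t.
rewrite (subquotient_ker pP) (subquotient_stable pP) //.
by rewrite (subquotient_hom pP) // (subquotient_ker0 pP) // mul0mx eqxx.
Qed.

Lemma eq_subquotient V (U1 U1' U2 U2' : family V) B :
  (forall t, U1 t :=: U2 t)%MS -> (forall t, U1' t :=: U2' t)%MS ->
  subquotient U1 U1' B -> subquotient U2 U2' B.
Proof.
move=> eqU eqU' [p pP]; exists p; have le t : (U2' t <= U1' t)%MS by rewrite eqU'.
split=> t.
- by rewrite -eqU' (subquotient_stable pP).
- exact: (subquotient_hom pP).
- case: pP => _ _ full _; have := full t; rewrite -!sub1mx => h.
  by apply: (submx_trans h); rewrite submxMr ?eqU'.
- apply: eqmx_trans (eqU t); case: pP => _ _ _ ker; apply: eqmx_trans (ker t).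
  by apply: cap_eqmx => //; exact: eqmx_sym.
Qed.

Definition img V B (p : graded_map V B) (U : family V) : family B :=
  fun t => <<U t *m p t>>%MS.

(* Taking [U0 = 0], [U3 = V], or both, this transports filtrations along
   subrepresentations, quotients and isomorphisms. *)
Lemma subquotient_img V (U0 U3 : family V) L (p : graded_map V L)
    (U U' : family V) B :
  subquotient_map U0 U3 p ->
  (forall t, U0 t <= U t)%MS -> (forall t, U t <= U' t)%MS ->
  (forall t, U' t <= U3 t)%MS ->
  subquotient U U' B <-> subquotient (img p U) (img p U') B.
Proof.
move=> pP U0U UU' U'U3.
have U0U' t : (U0 t <= U' t)%MS := submx_trans (U0U t) (UU' t).
split=> -[q qP].
  have [s sP] := subquotient_section pP.
  (* Going to [L] and back along the section changes a vector of [U'] only by an element of [U0].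
     This error lies in [U], so [q] does not see it, and [s] followed by [q] is the required map. *)
  have lift m t (X : 'M_(m, V t)) : (X <= U' t)%MS ->
    (X *m p t *m s t <= U' t)%MS /\ X *m p t *m s t *m q t = X *m q t.
    move=> XU'; have [sU3 sp] := sP t.
    have : (X *m p t *m s t - X <= U0 t)%MS.
      rewrite (subquotient_ker pP) mulmxBl -(mulmxA _ (s t)) sp mulmx1 subrr eqxx.
      by rewrite addmx_sub ?mulmx_sub // eqmx_opp (submx_trans XU').
    move=> dU0; have dU : (X *m p t *m s t - X <= U t)%MS by apply: submx_trans (U0U t).
    split; last by apply/eqP; rewrite -subr_eq0 -mulmxBl (subquotient_ker0 qP).
    by rewrite -(subrK X (_ *m s t)) addmx_sub // (submx_trans dU).
  exists (fun t => s t *m q t); split=> t; rewrite /img.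
  - rewrite !genmxE; have /submxP[D ->]: (<<U' t *m p t>> <= U' t *m p t)%MS.
      by rewrite genmxE.
    rewrite -!mulmxA mulmx_sub // mulmxA -(subquotient_hom pP) // submxMr //.
    exact: (subquotient_stable qP).
  - have /submxP[D ->]: (<<U' t *m p t>> <= U' t *m p t)%MS by rewrite genmxE.
    rewrite -!mulmxA; congr (_ *m _); rewrite !mulmxA -(subquotient_hom pP) //.
    have [_ ->] := lift _ _ _ (subquotient_stable qP (submx_refl (U' t))).
    by have [_ ->] := lift _ _ _ (submx_refl (U' t)); rewrite (subquotient_hom qP).
  - case: qP => _ _ full _; have := full t; rewrite -!sub1mx => /submx_trans; apply.
    have [_ <-] := lift _ _ _ (submx_refl (U' t)).
    by rewrite -mulmxA submxMr ?genmxE.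
  - apply/eqmxP; apply/andP; split; last first.
      rewrite sub_capmx !genmxE submxMr //= sub_kermx.
      have [_ h] := lift _ _ _ (UU' t).
      by rewrite mulmxA h (subquotient_ker0 qP).
    set Y := (_ :&: _)%MS.
    have: (Y <= U' t *m p t)%MS by rewrite (submx_trans (capmxSl _ _)) ?genmxE.
    case/submxP => D eqY; have DU' : (D *m U' t <= U' t)%MS by apply: submxMl.
    have: Y *m (s t *m q t) == 0 by rewrite -sub_kermx capmxSr.
    rewrite eqY !mulmxA; have [_ ->] := lift _ _ _ DU' => Dq0.
    by rewrite genmxE submxMr // (subquotient_ker qP) DU'.
exists (fun t => p t *m q t).
have le t : (U' t *m p t <= img p U' t)%MS by rewrite genmxE.
split=> t.
- apply: (subquotient_le pP) (U0U' _) _ (U'U3 _) _.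
    exact: (subquotient_stable pP).
  rewrite (subquotient_hom pP) //; have := subquotient_stable qP (le t).
  by rewrite /img genmxE.
- by rewrite mulmxA (subquotient_hom pP) // (subquotient_hom qP) // !mulmxA.
- case: qP => _ _ full _; have := full t; rewrite -!sub1mx => /submx_trans; apply.
  by rewrite mulmxA submxMr // /img genmxE.
- apply/eqmxP; apply/andP; split; last first.
    rewrite sub_capmx UU' sub_kermx mulmxA (subquotient_ker0 qP) ?eqxx //.
    by rewrite /img genmxE.
  set Y := (_ :&: _)%MS; have YU' : (Y <= U' t)%MS by apply: capmxSl.
  apply: (subquotient_le pP) => //.
  - exact: submx_trans YU' (U'U3 t).
  - exact: submx_trans (UU' t) (U'U3 t).
  - suff: (Y *m p t <= img p U t)%MS by rewrite /img genmxE.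
    rewrite (subquotient_ker qP) (submx_trans _ (le t)) ?submxMr //=.
    by rewrite -mulmxA -sub_kermx capmxSr.
Qed.

Definition fam0 V : family V := fun=> 0.
Definition fam1 V : family V := fun=> 1%:M.

Lemma subquotient01 V W : subquotient (@fam0 V) (@fam1 V) W <-> isomorphic V W.
Proof.
split=> [[p pP]|[h [g [hh hg hK gK]]]].
  have [s sP] := subquotient_section pP.
  have pK t : p t *m s t = 1%:M.
    apply/eqP; rewrite -subr_eq0 -submx0 (subquotient_ker pP) submx1 mulmxBl.
    by rewrite -mulmxA (sP t).2 mulmx1 mul1mx subrr eqxx.
  have ph : hom p.
    by move=> t; rewrite -[arrow V t]mul1mx (subquotient_hom pP) ?submx1 // mul1mx.
  exists p, s; split=> // t; last exact: (sP t).2.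
  by rewrite -[arrow W t]mul1mx -(sP t).2 -[s t *m p t *m _]mulmxA -ph -!mulmxA
    pK mulmx1.
exists h; split=> t; rewrite /fam0 /fam1.
- exact: submx1.
- by rewrite !mul1mx hh.
- by rewrite mul1mx -sub1mx -gK submxMl.
- apply/eqmxP; rewrite sub0mx andbT submx0.
  set X := (_ :&: _)%MS; have: X *m h t == 0 by rewrite -sub_kermx capmxSr.
  move/eqP/(congr1 (mulmx^~ (g t))); rewrite -mulmxA hK mulmx1 mul0mx => X0; exact/eqP.
Qed.

Lemma img_bottom V (U U' : family V) B (p : graded_map V B) :
  subquotient_map U U' p -> forall t, (img p U t :=: fam0 B t)%MS.
Proof. by move=> pP t; rewrite /img (subquotient_ker0 pP) // genmx0. Qed.

Lemma img_top V (U U' : family V) B (p : graded_map V B) :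
  subquotient_map U U' p -> forall t, (img p U' t :=: fam1 B t)%MS.
Proof.
case=> _ _ full _ t; apply/eqmxP; rewrite submx1 /=.
by rewrite genmxE sub1mx full.
Qed.

(** The transport [subquotient_img] is applied to the whole interval from [U] to [U']: its image in
    [B] runs from zero to everything, where [subquotient01] identifies subquotients with isomorphic
    copies. *)
Lemma subquotient_iso V (U U' : family V) B B' :
  subquotient U U' B -> subquotient U U' B' <-> isomorphic B B'.
Proof.
case=> p pP; rewrite -subquotient01.
rewrite (@subquotient_img _ _ _ _ _ U U' B' pP) //; last exact: (subquotient_subset pP).
have eq0 := img_bottom pP; have eq1 := img_top pP.
by split; apply: eq_subquotient => // t; apply: eqmx_sym.
Qed.

Lemma subquotient_sub V (U : family V) : is_subrep U ->
  subquotient (@fam0 V) U (sub_rep U).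
Proof.
move=> st; exists (fun t => in_submod (U t) 1%:M).
have inE m t (X : 'M_(m, V t)) : X *m in_submod (U t) 1%:M = in_submod (U t) X.
  by rewrite -in_submodE.
have valE t : val_submod (in_submod (U t) (U t)) = U t by rewrite in_submodK.
split=> // t.
- have arrE m (Y : 'M_(m, \rank (U t))) : Y *m arrow (sub_rep U) t
      = in_submod (U t.+1) (val_submod Y *m arrow V t).
    rewrite [arrow _ _](in_submodE _ (val_submod 1%:M *m arrow V t)).
    by rewrite [RHS]in_submodE (val_submodE Y) !mulmxA.
  by rewrite arrE !inE valE.
- rewrite inE -sub1mx -val_submodS valE.
  exact: val_submodP.
- apply/eqmxP; rewrite sub0mx andbT submx0.
  set X := (_ :&: _)%MS; have XU : (X <= U t)%MS by apply: capmxSl.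
  have: X *m in_submod (U t) 1%:M == 0 by rewrite -sub_kermx capmxSr.
  by rewrite inE => /eqP X0; rewrite -(in_submodK XU) X0 linear0.
Qed.

Lemma subquotient_quot V (U : family V) : is_subrep U ->
  subquotient U (@fam1 V) (quot_rep U).
Proof.
move=> st; exists (fun t => in_factmod (U t) 1%:M).
have inE m t (X : 'M_(m, V t)) : X *m in_factmod (U t) 1%:M = in_factmod (U t) X.
  by rewrite -in_factmodE.
split=> t; rewrite /fam1 ?mul1mx; first exact: submx1.
- have arrE m (Y : 'M_(m, \rank (cokermx (U t)))) : Y *m arrow (quot_rep U) t
      = in_factmod (U t.+1) (val_factmod Y *m arrow V t).
    rewrite [arrow _ _](in_factmodE _ (val_factmod 1%:M *m arrow V t)).
    by rewrite [RHS]in_factmodE (val_factmodE Y) !mulmxA.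
  rewrite arrE inE; apply/eqP; rewrite -subr_eq0 -linearB in_factmod_eq0.
  rewrite -[X in (X - _ <= _)%MS]mul1mx -mulmxBl.
  apply: submx_trans (st t); apply: submxMr.
  rewrite -in_factmod_eq0 -inE mulmxBl !inE. 
  by rewrite val_factmodK subrr.
- by rewrite -sub1mx -[X in (X <= _)%MS](@val_factmodK _ _ (U t)) -inE submxMl.
- apply/eqmxP; rewrite cap1mx -in_factmod_eq0 -inE mulmx_ker eqxx.
  by rewrite sub_kermx inE in_factmod_eq0 submx_refl.
Qed.

Definition filtration V (U0 U U3 : family V) A B : Prop :=
  [/\ forall t, <<U t>>%MS = U t, subquotient U0 U B & subquotient U U3 A].

End Subquotients.

(** Removes the chosen bases of [sub_rep] and [quot_rep]: sub and quotient become the two steps of a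
    filtration, the form in which they can be transported and refined. *)
Lemma hall_setE (k : fieldType) Q (a b l : isoclass Q) :
  @hall_set k Q a b l = [set U | filtration (@fam0 _ _ (mod_of k l)) U
     (@fam1 _ _ (mod_of k l)) (mod_of k a) (mod_of k b)].
Proof.
apply/seteqP; split=> U /=.
  case=> Ucan st Ub Ua; split=> //.
    exact/(subquotient_iso _ (subquotient_sub st)).
  exact/(subquotient_iso _ (subquotient_quot st)).
case=> Ucan Ub Ua; have st : is_subrep U by case: (Ub) => p [].
split=> //.
  exact/(subquotient_iso _ (subquotient_sub st)).
exact/(subquotient_iso _ (subquotient_quot st)).
Qed.

(** * Counting filtrations over a finite field *)

Lemma count_bijection (T1 T2 : eqType) (s1 : seq T1) (s2 : seq T2)
    (P1 : pred T1) (P2 : pred T2) (f : T1 -> T2) (g : T2 -> T1) :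
    uniq s1 -> uniq s2 ->
    (forall x, x \in s1 -> P1 x -> [/\ f x \in s2, P2 (f x) & g (f x) = x]) ->
    (forall y, y \in s2 -> P2 y -> [/\ g y \in s1, P1 (g y) & f (g y) = y]) ->
  count P1 s1 = count P2 s2.
Proof.
have le (S1 S2 : eqType) (r1 : seq S1) (r2 : seq S2) (Q1 : pred S1)
    (Q2 : pred S2) (h : S1 -> S2) (i : S2 -> S1) : uniq r1 ->
    (forall x, x \in r1 -> Q1 x -> [/\ h x \in r2, Q2 (h x) & i (h x) = x]) ->
    (count Q1 r1 <= count Q2 r2)%N.
  move=> u1 hi; rewrite -!size_filter -(size_map h); apply: uniq_leq_size.
    rewrite map_inj_in_uniq ?filter_uniq // => x y.
    rewrite !mem_filter => /andP[Qx xr] /andP[Qy yr] e.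
    by have [_ _ <-] := hi _ xr Qx; have [_ _ <-] := hi _ yr Qy; rewrite e.
  move=> _ /mapP[x + ->]; rewrite !mem_filter => /andP[Qx xr].
  by have [-> -> _] := hi _ xr Qx.
move=> u1 u2 fg gf; apply/eqP; rewrite eqn_leq.
by rewrite (le _ _ _ _ _ _ f g) // (le _ _ _ _ _ _ g f).
Qed.

Section Counting.
Variables (k : finFieldType) (Q : quiver).
Implicit Types V W A B C L : rep k Q.

(** A family is indexed by all vertices, but beyond a bound of the support its matrices are empty,
    so its finitely many values below the bound determine it. *)
Lemma finite_family V : finite_set [set: family V].
Proof.
have [N VN] := rdim_finite V.
pose r (U : family V) : {dffun forall i : 'I_N, 'M[k]_(V i)} := [ffun i => U (val i)].
rewrite (_ : setT = r @^-1` setT) //; apply: finite_preimage; last first.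
  exact: finite_finset.
move=> U U' _ _ e; apply: functional_extensionality_dep => t.
have [tN|Nt] := ltnP t N.
  have := congr1 (fun g : {dffun forall i : 'I_N, 'M[k]_(V i)} => g (Ordinal tN)) e.
  by rewrite !ffunE.
by move: (U t) (U' t); rewrite (VN _ Nt) => x y; rewrite !flatmx0.
Qed.

Definition families V : seq (family V) := fset_set [set: family V].

Lemma families_uniq V : uniq (families V). Proof. exact: fset_uniq. Qed.

Lemma mem_families V U : U \in families V.
Proof. by rewrite in_fset_set ?inE //; exact: finite_family. Qed.

Lemma card_eq_count V (S : set (family V)) n :
  S #= `I_n -> count (fun U => `[<S U>]) (families V) = n.
Proof.
move=> Sn; rewrite -(card_fset_set Sn) -size_filter.
have Sfin : finite_set S by apply: sub_finite_set (finite_family V).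
apply/perm_size/uniq_perm; rewrite ?filter_uniq ?families_uniq ?fset_uniq // => U.
by rewrite mem_filter mem_families andbT in_fset_set // mem_setE.
Qed.

Definition filtration_count V (U0 U3 : family V) A B : nat :=
  count (fun U => `[< filtration U0 U U3 A B >]) (families V).

Definition hall_number V A B := filtration_count (@fam0 _ _ V) (@fam1 _ _ V) A B.

Lemma filtration_count_img V (U0 U3 : family V) L (p : graded_map V L) A B :
  subquotient_map U0 U3 p -> filtration_count U0 U3 A B = hall_number L A B.
Proof.
move=> pP; have [s sP] := subquotient_section pP.
have eq0 := img_bottom pP; have eq1 := img_top pP.
(* The inverse correspondence takes the full preimage in [U3], which is [U0] plus the lift along the
   section, brought to canonical form. *)
pose g (W : family L) : family V := fun t => <<(U0 t + (W t *m s t)%R)%MS>>%MS.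
have gU0 (W : family L) t : (U0 t <= g W t)%MS by rewrite genmxE addsmxSl.
have gU3 (W : family L) t : (g W t <= U3 t)%MS.
  by rewrite genmxE addsmx_sub (subquotient_subset pP) mulmx_sub ?(sP t).1.
have gK (W : family L) t : (g W t *m p t :=: W t)%MS.
  apply: (eqmx_trans (eqmxMr _ (genmxE _))).
  apply: (eqmx_trans (addsmxMr _ _ _)).
  rewrite (subquotient_ker0 pP) // -mulmxA (sP t).2 mulmx1.
  exact: adds0mx.
apply: (count_bijection (f := img p) (g := g));
  [exact: families_uniq | exact: families_uniq | |].
- move=> U _ /asboolP[Ucan [q qP] [r rP]]; rewrite mem_families.
  have U0U := subquotient_subset qP; have UU3 := subquotient_subset rP.
  have UB : subquotient U0 U B by exists q.
  have UA : subquotient U U3 A by exists r.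
  split=> //; last first.
    apply: functional_extensionality_dep => t; rewrite -[RHS]Ucan.
    apply/eq_genmx/eqmxP/andP; split.
      rewrite addsmx_sub U0U /=; apply: (subquotient_le pP) => //.
        by rewrite mulmx_sub ?(sP t).1.
      by rewrite -mulmxA (sP t).2 mulmx1 genmxE.
    apply: (subquotient_le pP) => //; first exact: addsmxSl.
      by rewrite addsmx_sub (subquotient_subset pP) mulmx_sub ?(sP t).1.
    apply: (submx_trans _ (submxMr _ (addsmxSr _ _))).
    by rewrite -mulmxA (sP t).2 mulmx1 genmxE.
  apply/asboolP; split=> [t||]; first exact: genmx_id.
  - apply: (eq_subquotient eq0 (fun t => eqmx_refl _)).
    by apply: (iffLR (subquotient_img _ pP _ _ _)).
  - apply: (eq_subquotient (fun t => eqmx_refl _) eq1).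
    by apply: (iffLR (subquotient_img _ pP _ _ _)).
- move=> W _ /asboolP[Wcan WB WA]; rewrite mem_families.
  have gWK : img p (g W) = W.
    by apply: functional_extensionality_dep => t; rewrite -[RHS]Wcan; apply/eq_genmx/gK.
  split=> //; apply/asboolP; split=> [t||]; first exact: genmx_id.
  - rewrite (subquotient_img _ pP) //= gWK.
    by apply: (eq_subquotient _ (fun t => eqmx_refl _)) WB => t; apply: eqmx_sym.
  - rewrite (subquotient_img _ pP) //= gWK.
    by apply: (eq_subquotient (fun t => eqmx_refl _)) WA => t; apply: eqmx_sym.
Qed.

Lemma hall_number_iso V V' A A' B B' : isomorphic V V' -> isomorphic A A' ->
  isomorphic B B' -> hall_number V A B = hall_number V' A' B'.
Proof.
move=> VV' AA' BB'; have [p pP] := (subquotient01 V V').2 VV'.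
rewrite -(filtration_count_img _ _ pP); apply: eq_count => U.
apply/asbool_equiv_eq; split=> -[Ucan UB UA]; split=> //.
- by apply/(subquotient_iso _ UB).
- by apply/(subquotient_iso _ UA).
- by apply/(subquotient_iso _ UB)/isomorphic_sym.
- by apply/(subquotient_iso _ UA)/isomorphic_sym.
Qed.

Lemma hall_number_neq0 V A B : hall_number V A B != 0%N ->
  exists U, filtration (@fam0 _ _ V) U (@fam1 _ _ V) A B.
Proof.
rewrite -lt0n -has_count => /hasP[U _ /asboolP UP]; by exists U.
Qed.

Lemma hall_number_dim V A B : hall_number V A B != 0%N ->
  forall t, V t = (A t + B t)%N.
Proof.
case/hall_number_neq0 => U [_ [p pP] [q qP]] t.
have := subquotient_dim qP t; rewrite -(subquotient_dim pP t).
by rewrite mxrank0 mxrank1 add0n addnC.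
Qed.

(** * Associativity of Hall numbers *)

Section Chains.
Variables (I : eqType) (M : I -> rep k Q).
Hypothesis M_surj : forall V, exists i, isomorphic V (M i).
Hypothesis M_inj : forall i j, isomorphic (M i) (M j) -> i = j.

(** Only the index [i] satisfies [S], so the sum collapses to one term. If [s] misses [i], both
    sides are zero, which lets [s] be any list containing the support of [P]. *)
Lemma sum_hall_number (S : I -> Prop) (s : seq I) (P : I -> nat) i :
  uniq s -> (P i != 0%N -> i \in s) -> S i -> (forall j, S j -> i = j) ->
  (\sum_(j <- s) `[<S j>] * P j = P i)%N.
Proof.
move=> us Pis Si Suniq.
have [is_|nis] := boolP (i \in s).
  rewrite (bigD1_seq i) //= asboolT // mul1n big1 ?addn0 // => j.
  by apply: contraNeq; rewrite muln_eq0 => /norP[]; case: asboolP => // /Suniq ->.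
rewrite (eqP (contraNT Pis nis)) big1_seq // => j /= js; case: asboolP => // /Suniq e.
by rewrite e js in nis.
Qed.

Lemma hall_number_assoc V A B C (s1 s2 : seq I) : uniq s1 -> uniq s2 ->
  (forall i, hall_number (M i) A B != 0%N -> i \in s1) ->
  (forall i, hall_number (M i) B C != 0%N -> i \in s2) ->
  (\sum_(i <- s1) hall_number (M i) A B * hall_number V (M i) C =
   \sum_(i <- s2) hall_number (M i) B C * hall_number V A (M i))%N.
Proof.
move=> us1 us2 s1P s2P.
pose can (U : family V) := forall t, <<U t>>%MS = U t.
have quot (U : family V) D : subquotient (@fam0 _ _ V) U D ->
    exists i, subquotient U (@fam1 _ _ V) (M i).
  case=> p pP; have /subquotient_quot UQ : is_subrep U by case: pP.
  have [i Qi] := M_surj (quot_rep U); exists i.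
  exact/(subquotient_iso _ UQ).
have sub (U : family V) D : subquotient U (@fam1 _ _ V) D ->
    exists i, subquotient (@fam0 _ _ V) U (M i).
  case=> p pP; have /subquotient_sub UQ := subquotient_subrepl pP.
  have [i Qi] := M_surj (sub_rep U); exists i.
  exact/(subquotient_iso _ UQ).
(* Both sides are compared with the number of pairs of canonical families forming a chain with
   factors [C], [B], [A] from the bottom up; the inclusion of [U1] in [U2] is part of the middle
   subquotient condition. *)
transitivity (\sum_(U1 <- families V) \sum_(U2 <- families V)
   `[< [/\ can U1, can U2, subquotient (@fam0 _ _ V) U1 C, subquotient U1 U2 B
         & subquotient U2 (@fam1 _ _ V) A] >])%N.
  under eq_bigr do rewrite [X in (_ * X)%N]/hall_number /filtration_count
     -sum1_count big_mkcond big_distrr /=.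
  rewrite exchange_big; apply: eq_bigr => U1 _.
  have [[U1can U1C]|nU1] := pselect (can U1 /\ subquotient (@fam0 _ _ V) U1 C);
      last first.
    rewrite !big1 // => [U2|i] _.
      by rewrite asboolF // => -[*]; apply: nU1.
    by rewrite asboolF ?muln0 // => -[*]; apply: nU1.
  (* For fixed [U1] exactly one [M i] is isomorphic to the quotient by [U1], and transport along [p]
     turns its Hall number into the number of possible [U2]. *)
  have [i U1i] := quot _ _ U1C.
  have [p pP] := U1i.
  transitivity (\sum_(j <- s1)
      `[<subquotient U1 (@fam1 _ _ V) (M j)>] * hall_number (M j) A B)%N.
    apply: eq_bigr => j _; rewrite mulnC.
    do 2!case: asboolP => //=.
      by move=> nQ [_ _ /nQ].
    by move=> Qj []; split.
  rewrite (sum_hall_number (i := i)) //; last first.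
  - by move=> j Qj; apply/M_inj/(subquotient_iso _ U1i).
  - exact: s1P.
  rewrite -(filtration_count_img _ _ pP) /filtration_count -sum1_count big_mkcond /=.
  apply: eq_bigr => U2 _; do 2!case: asboolP => //=.
    by move=> nQ [U2can U12 U2A]; case: nQ.
  by move=> [? ? ? ? ?] []; split.
rewrite exchange_big; apply/esym.
under eq_bigr do rewrite [X in (_ * X)%N]/hall_number /filtration_count
   -sum1_count big_mkcond big_distrr /=.
rewrite [LHS]exchange_big; apply: eq_bigr => U2 _.
have [[U2can U2A]|nU2] := pselect (can U2 /\ subquotient U2 (@fam1 _ _ V) A);
    last first.
  rewrite !big1 // => [U1|i] _.
    by rewrite asboolF // => -[*]; apply: nU2.
  by rewrite asboolF ?muln0 // => -[*]; apply: nU2.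
(* Dually, for fixed [U2] exactly one [M i] is isomorphic to [U2], and its Hall number counts the
   possible [U1]. *)
have [i U2i] := sub _ _ U2A.
have [p pP] := U2i.
transitivity (\sum_(j <- s2)
    `[<subquotient (@fam0 _ _ V) U2 (M j)>] * hall_number (M j) B C)%N.
  apply: eq_bigr => j _; rewrite mulnC.
  do 2!case: asboolP => //=.
    by move=> nQ [_ /nQ].
  by move=> Qj []; split.
rewrite (sum_hall_number (i := i)) //; last first.
- by move=> j Qj; apply/M_inj/(subquotient_iso _ U2i).
- exact: s2P.
rewrite -(filtration_count_img _ _ pP) /filtration_count -sum1_count big_mkcond /=.
apply: eq_bigr => U1 _; do 2!case: asboolP => //=.
  by move=> nQ [U1can U01 U12]; case: nQ.
by move=> [? ? ? ? ?] []; split.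
Qed.

End Chains.
End Counting.

(** * Decomposition into interval modules *)

Section Classification.
Variables (k : fieldType) (Q : quiver).
Implicit Types V W X : rep k Q.

Lemma hom_isomorphic V W (h : graded_map V W) (g : graded_map W V) :
  hom h -> (forall t, h t *m g t = 1%:M) -> (forall t, g t *m h t = 1%:M) ->
  isomorphic V W.
Proof.
move=> hh hK gK; exists h, g; split=> // t.
by rewrite -[arrow W t]mul1mx -gK -!mulmxA [h t *m _]mulmxA -hh -!mulmxA hK mulmx1.
Qed.

Lemma dsum_isomorphic V V' W W' :
  isomorphic V V' -> isomorphic W W' -> isomorphic (dsum V W) (dsum V' W').
Proof.
case=> h [g [hh _ hK gK]] [h' [g' [hh' _ hK' gK']]].
apply: (@hom_isomorphic (dsum V W) (dsum V' W')
   (fun t => block_mx (h t) 0 0 (h' t))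
   (fun t => block_mx (g t) 0 0 (g' t))) => t /=;
rewrite !mulmx_block !(mul0mx, mulmx0, add0r, addr0) ?hh ?hh' //.
  by rewrite hK hK' -scalar_mx_block.
by rewrite gK gK' -scalar_mx_block.
Qed.

Lemma dsumCA V W X : isomorphic (dsum V (dsum W X)) (dsum W (dsum V X)).
Proof.
pose h (A B C : rep k Q) t : 'M[k]_(A t + (B t + C t), B t + (A t + C t)) :=
  block_mx 0 (row_mx 1%:M 0) (col_mx 1%:M 0) (block_mx 0 0 0 1%:M).
pose simp := (mul0mx, mulmx0, mul1mx, mulmx1, add0r, addr0).
have hK (A B C : rep k Q) t : h A B C t *m h B A C t = 1%:M.
  rewrite /h !mulmx_block !simp.
  rewrite mul_row_block mul_block_col mul_row_col mul_col_row !simp.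
  rewrite add_block_mx !simp.
  by rewrite row_mx0 col_mx0 -!scalar_mx_block.
apply: (@hom_isomorphic (dsum V (dsum W X)) (dsum W (dsum V X))
  (h V W X) (h W V X)) => t; rewrite ?hK //.
rewrite /h /= !mulmx_block !simp.
by rewrite mul_row_block mul_block_col mul_mx_row mul_col_mx !simp.
Qed.

Lemma flatmx_eq m n (A B : 'M[k]_(m, n)) : m = 0%N -> A = B.
Proof. by move=> m0; move: A B; rewrite m0 => A B; rewrite !flatmx0. Qed.

Lemma thinmx_eq m n (A B : 'M[k]_(m, n)) : n = 0%N -> A = B.
Proof. by move=> n0; move: A B; rewrite n0 => A B; rewrite !thinmx0. Qed.

Lemma zero_isomorphic V : (forall t, V t = 0%N) -> isomorphic V (zero_rep k Q).
Proof.
move=> V0; apply: (@hom_isomorphic _ _ (fun=> 0) (fun=> 0)) => t.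
- exact: flatmx_eq.
- exact: flatmx_eq.
- by rewrite [1%:M]flatmx0 mulmx0.
Qed.

(** A retract is a direct summand: the complement is the kernel of [g], and the projection onto it
    is the identity minus the idempotent [g t *m f t]. *)
Lemma split_isomorphic V W (f : graded_map W V) (g : graded_map V W) :
  hom f -> hom g -> (forall t, f t *m g t = 1%:M) ->
  exists X, isomorphic V (dsum W X).
Proof.
move=> fh gh fg; pose U t : 'M[k]_(V t) := kermx (g t).
have U0 m t (Y : 'M_(m, V t)) : (Y <= U t)%MS = (Y *m g t == 0).
  exact: sub_kermx.
have inU t : (1%:M - g t *m f t <= U t)%MS.
  by rewrite U0 mulmxBl -mulmxA fg mulmx1 mul1mx subrr.
have valE m t (Y : 'M_(m, \rank (U t))) : Y *m val_submod 1%:M = val_submod Y.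
  by rewrite -val_submodE.
have inE m t (Y : 'M_(m, V t)) : Y *m in_submod (U t) (1%:M - g t *m f t)
    = in_submod (U t) (Y - Y *m g t *m f t).
  rewrite in_submodE [RHS]in_submodE mulmxA; congr (_ *m _).
  by rewrite mulmxBr mulmx1 mulmxA.
exists (sub_rep U); apply: isomorphic_sym.
apply: (@hom_isomorphic (dsum W (sub_rep U)) V
   (fun t => col_mx (f t) (val_submod (1%:M : 'M_(\rank (U t)))))
   (fun t => row_mx (g t) (in_submod (U t) (1%:M - g t *m f t)))) => t.
- rewrite mul_block_col mul_col_mx !mul0mx addr0 add0r fh valE in_submodK //.
  rewrite U0 -mulmxA gh mulmxA.
  by rewrite (_ : _ *m g t = 0) ?mul0mx //; apply/eqP; rewrite -U0 val_submodP.
- rewrite mul_col_row !inE fg mul1mx subrr linear0.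
  rewrite (_ : _ *m g t = 0); last by apply/eqP; rewrite -U0 val_submodP.
  by rewrite mul0mx subr0 val_submodK -scalar_mx_block.
- by rewrite mul_row_col valE in_submodK // addrC subrK.
Qed.

(** Used where the dimensions are at most 1: the scalar is then 1 or 0 according to whether the
    composite passes through a nonzero space. *)
Lemma const_mx1M m n p :
  (const_mx 1 : 'M[k]_(m, n)) *m (const_mx 1 : 'M_(n, p)) = const_mx n%:R.
Proof.
apply/matrixP => i j; rewrite !mxE (eq_bigr (fun=> 1)) => [|l _].
  by rewrite sumr_const card_ord.
by rewrite !mxE mulr1.
Qed.

Fixpoint path_mx V s n : 'M[k]_(V s, V (n + s)%N) :=
  if n is n'.+1 then path_mx V s n' *m arrow V (n' + s) else 1%:M.

Lemma path_hom V W (h : graded_map V W) s n :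
  hom h -> path_mx V s n *m h (n + s)%N = h s *m path_mx W s n.
Proof.
move=> hh; elim: n => [|n IHn] /=; first by rewrite mul1mx mulmx1.
by rewrite -mulmxA [arrow _ _ *m _]hh mulmxA IHn mulmxA.
Qed.

Lemma path_rank_iso V W s n :
  isomorphic V W -> \rank (path_mx V s n) = \rank (path_mx W s n).
Proof.
have le V' W' : isomorphic V' W' -> (\rank (path_mx V' s n) <= \rank (path_mx W' s n))%N.
  case=> h [g [hh _ hK _]].
  have ->: path_mx V' s n = h s *m path_mx W' s n *m g (n + s)%N.
    by rewrite -path_hom // -mulmxA hK mulmx1.
  by rewrite (leq_trans (mxrankM_maxl _ _)) ?mxrankM_maxr.
by move=> VW; apply/eqP; rewrite eqn_leq !le //; exact: isomorphic_sym.
Qed.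

Lemma path_dsum V W s n :
  path_mx (dsum V W) s n = block_mx (path_mx V s n) 0 0 (path_mx W s n).
Proof.
elim: n => [|n IHn] /=; first exact: scalar_mx_block.
by rewrite IHn /= mulmx_block !(mul0mx, mulmx0, addr0, add0r).
Qed.

Lemma path_rank_interval (c : proot Q) s n :
  \rank (path_mx (interval_rep k c) s n) =
  ((val c).1 <= s)%N && (n + s <= (val c).2)%N :> nat.
Proof.
have [/andP[is_ sj]|] := boolP (((val c).1 <= s)%N && (n + s <= (val c).2)%N).
  suff ->: path_mx (interval_rep k c) s n = const_mx 1.
    rewrite /= is_ /= (leq_trans (leq_addl n s) sj) (leq_trans is_ (leq_addl n s)) sj.
    rewrite (_ : const_mx 1 = 1%:M) ?mxrank1 //.
    by apply/matrixP => x y; rewrite !mxE !ord1.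
  elim: n sj => [|n IHn] sj /=.
    rewrite is_ sj /=; apply/matrixP => x y; rewrite !mxE.
    by case: x y => [[|//] ?] [[|//] ?].
  have sj' := ltnW sj; rewrite IHn // const_mx1M /=.
  by rewrite (leq_trans is_ (leq_addl n s)) sj'.
rewrite negb_and -!ltnNge => /orP out; apply/eqP; rewrite -leqn0.
case: out => [si|js].
  by apply: leq_trans (rank_leq_row _) _; move: si => /=; rewrite ltnNge => /negbTE ->.
apply: leq_trans (rank_leq_col _) _.
by move: js => /=; rewrite andbC ltnNge => /negbTE ->.
Qed.

Definition module_of (cs : seq (proot Q)) : rep k Q :=
  foldr (@dsum k Q) (zero_rep k Q) [seq interval_rep k c | c <- cs].

Lemma module_of_dim cs t :
  module_of cs t = count (fun c : proot Q => ((val c).1 <= t <= (val c).2)%N) cs.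
Proof. by elim: cs => //= c cs <-. Qed.

Lemma module_of_path_rank cs s n : \rank (path_mx (module_of cs) s n) =
  count (fun c : proot Q => ((val c).1 <= s)%N && (n + s <= (val c).2)%N) cs.
Proof.
elim: cs => [|c cs IHcs]; first by rewrite /module_of /= [path_mx _ _ _]flatmx0 mxrank0.
by rewrite -[module_of _]/(dsum _ _) path_dsum rank_diag_block_mx IHcs
  path_rank_interval.
Qed.

Lemma module_of_perm cs cs' :
  perm_eq cs cs' -> isomorphic (module_of cs) (module_of cs').
Proof.
have rot c s : c \in s -> isomorphic (module_of s) (module_of (c :: rem c s)).
  elim: s => //= d s IHs; rewrite inE eq_sym.
  case: eqVneq => [-> _|dc /= c_s]; first exact: isomorphic_refl.
  apply: isomorphic_trans (dsumCA _ _ _).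
  by apply: dsum_isomorphic (IHs c_s); exact: isomorphic_refl.
elim: cs cs' => [|c cs IHcs] cs' p.
  by move: p; rewrite perm_sym => /perm_nilP ->; exact: isomorphic_refl.
have ccs' : c \in cs' by rewrite -(perm_mem p) mem_head.
apply: isomorphic_trans (isomorphic_sym (rot _ _ ccs')).
apply: dsum_isomorphic; first exact: isomorphic_refl.
apply: IHcs; rewrite -(perm_cons c).
by apply: (perm_trans p); exact: perm_to_rem.
Qed.

(* The multiplicity of a root [i, j] is the alternating sum of the ranks of the
   paths i -> j, i-1 -> j, i -> j+1, i-1 -> j+1. *)
Lemma module_of_inj cs cs' :
  isomorphic (module_of cs) (module_of cs') -> perm_eq cs cs'.
Proof.
move=> iso; apply/allP => /= c _; apply/eqP.
pose N (s : seq (proot Q)) i j :=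
  count (fun c : proot Q => ((val c).1 <= i)%N && (j <= (val c).2)%N) s.
have NE i j : (i <= j)%N -> N cs i j = N cs' i j.
  move=> ij; have := path_rank_iso i (j - i) iso.
  by rewrite !module_of_path_rank subnK.
case: c => -[i j] /= ijP.
have [/andP[/andP[i0 _] _] /= ij] := andP ijP; rewrite /= in i0 ij.
(* The alternating sum is written without subtraction and checked root by root. Vertices are
   positive, so [i.-1] is a genuine predecessor. *)
have E s : (count_mem (exist _ (i, j) ijP : proot Q) s + N s i.-1 j + N s i j.+1
    = N s i j + N s i.-1 j.+1)%N.
  elim: s => //= d s; have ->: (d == exist _ (i, j) ijP) = (val d == (i, j)) by [].
  case: (d) => -[i' j'] /= _; rewrite xpair_eqE /N /=.
  set x := count _ s; set y := count _ s; set z := count _ s.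
  by move=> IH; lia.
have := E cs; rewrite !NE ?(leq_trans (leq_pred i)) ?leqW //.
by rewrite -(E cs') => /addIn/addIn.
Qed.

(* The orbit of the i-th basis vector spans an interval [s, n + s], which
   path_max ends; pairing it with the pullbacks of the j-th coordinate form
   gives a retraction, because s is the lowest vertex of the support. *)
Section IntervalSummand.
Variables (V : rep k Q) (s n : nat) (i : 'I_(V s)) (j : 'I_(V (n + s)%N)).
Variable c : proot Q.
Hypothesis c_ends : val c = (s, (n + s)%N).
Hypothesis s_min : forall t, (t < s)%N -> V t = 0%N.
Hypothesis path_ij : path_mx V s n i j != 0.
Hypothesis path_max : path_mx V s n.+1 = 0.

(** Comparing indices as natural numbers gives a starting vector at every vertex without a cast
    along [t = s]. Below [s] the vector lies in a zero space. *)
Fixpoint forward_orbit t : 'rV[k]_(V t) :=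
  let start t' := \row_(l < V t') ((l == i :> nat)%:R : k) in
  if t is t'.+1 then if (t' < s)%N then start t'.+1 else forward_orbit t' *m arrow V t'
  else start 0%N.

Fixpoint backward_orbit m t : 'cV[k]_(V t) :=
  if m is m'.+1 then arrow V t *m backward_orbit m' t.+1
  else \col_(l < V t) ((l == j :> nat)%:R : k).

Lemma orbitS t : (s <= t)%N -> forward_orbit t.+1 = forward_orbit t *m arrow V t.
Proof. by move=> st; rewrite /= ltnNge st. Qed.

Lemma orbit_start : forward_orbit s = delta_mx 0 i.
Proof.
have start t : t = s -> forward_orbit t = \row_(l < V t) ((l == i :> nat)%:R : k).
  by case: t => //= t ts; rewrite ifT; last lia.
by rewrite start //; apply/rowP => l; rewrite !mxE eqxx.
Qed.

Lemma orbit_path m : forward_orbit (m + s) = delta_mx 0 i *m path_mx V s m.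
Proof.
elim: m => [|m IHm]; first by rewrite mulmx1; exact: orbit_start.
by rewrite [LHS](orbitS (leq_addl m s)) IHm -mulmxA.
Qed.

(** An arrow can be moved from the linear form to the vector, so the pairing has the same value at
    all vertices from [s] to [n + s]; at the last one it is a matrix entry of the path. *)
Lemma orbit_coorbit m t : (s <= t)%N -> (t + m = n + s)%N ->
  forward_orbit t *m backward_orbit m t = (path_mx V s n i j)%:M.
Proof.
elim: m t => [|m IHm] t st; rewrite ?addn0 ?addnS => tm.
  rewrite tm orbit_path.
  have ->: backward_orbit 0 (n + s) = delta_mx j 0.
    by apply/colP => l; rewrite !mxE eqxx andbT.
  apply/rowP => l; rewrite -rowE -colE !mxE.
  by rewrite (ord1 l) eqxx.
by rewrite /= mulmxA -orbitS // IHm // ?(leq_trans st) // addSn.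
Qed.

Lemma interval_summand : exists X, isomorphic V (dsum (interval_rep k c) X).
Proof.
pose I := interval_rep k c.
have I1 t : (s <= t <= n + s)%N -> I t = 1%N by rewrite /= c_ends /= => ->.
have I0 t : ~~ (s <= t <= n + s)%N -> I t = 0%N.
  by rewrite /= c_ends /= => /negbTE ->.
pose f t : 'M[k]_(I t, V t) := const_mx 1 *m forward_orbit t.
(* The inverse of the constant value of the pairing makes [g] a retraction of [f]. *)
pose g t : 'M[k]_(V t, I t) :=
  (path_mx V s n i j)^-1 *: (backward_orbit (n + s - t) t *m const_mx 1).
have const1 m : m = 1%N -> const_mx 1 = 1%:M :> 'M[k]_m.
  by move->; apply/matrixP => x y; rewrite !mxE !ord1.
apply: (@split_isomorphic V I f g) => t.
- rewrite [arrow I t](_ : _ = const_mx 1) // /f mulmxA const_mx1M.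
  have [tI|/I0 It] := boolP (s <= t <= n + s)%N; last exact: flatmx_eq.
  case/andP: (tI) => st tn; rewrite -mulmxA -orbitS //.
  (* At the right end the arrow of the interval is zero, and [path_max] makes the orbit stop there
     as well. *)
  move: tn; rewrite leq_eqVlt => /orP[/eqP tn|tn].
    have ->: forward_orbit t.+1 = 0; last by rewrite !mulmx0.
    by rewrite orbitS // tn orbit_path -mulmxA [_ *m arrow _ _]path_max mulmx0.
  by rewrite (I1 t.+1) // tn leqW.
- rewrite [arrow I t](_ : _ = const_mx 1) // /g -scalemxAr -scalemxAl -mulmxA.
  rewrite const_mx1M mulmxA.
  have [tn|tn] := ltnP t (n + s); last first.
    by apply: thinmx_eq; apply: I0; rewrite ltnNge tn andbF.
  have [st|ts] := leqP s t; last by apply: flatmx_eq; exact: s_min.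
  by rewrite (I1 t) ?st ?(ltnW tn) // -(subnSK tn).
- have [tI|/I0 It] := boolP (s <= t <= n + s)%N; last exact: flatmx_eq.
  case/andP: (tI) => st tn.
  rewrite /f /g -scalemxAr mulmxA -[_ *m forward_orbit t *m _]mulmxA orbit_coorbit //; last first.
    by rewrite subnKC.
  rewrite -mulmxA mul_scalar_mx -scalemxAr scalerA mulVf // scale1r const_mx1M.
  exact/const1/I1.
Qed.

End IntervalSummand.

(** Let [s] be the lowest vertex of the support and take a longest nonzero path from [s]. A nonzero
    entry of its matrix supplies the basis vector and the coordinate form that split off an
    interval. *)
Lemma interval_split V t : V t != 0%N ->
  exists c X, isomorphic V (dsum (interval_rep k c) X).
Proof.
move=> Vt; have exV : exists t, V t != 0%N by exists t.
case: (ex_minnP exV) => s Vs s_min {t Vt exV}.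
have [N VN] := rdim_finite V.
have path0 : exists n, path_mx V s n != 0.
  exists 0%N; apply: contraNneq Vs => /= /(congr1 mxrank).
  by rewrite mxrank1 mxrank0 => ->.
have pathN n : path_mx V s n != 0 -> (n <= N)%N.
  apply: contraR; rewrite -ltnNge => Nn; apply/eqP/thinmx_eq/VN.
  by rewrite (leq_trans (ltnW Nn)) ?leq_addr.
case: (ex_maxnP path0 pathN) => n pn n_max.
have [i [j pij]] : exists i j, path_mx V s n i j != 0.
  apply: contrapT => no; case/eqP: pn; apply/matrixP => i j; rewrite mxE.
  by apply: contrapT => /eqP pij; apply: no; exists i, j.
have Vn : V (n + s)%N != 0%N by apply: contraNneq pn => V0; apply/eqP/thinmx_eq.
have vertexP t : V t != 0%N -> vertex Q t.
  by apply: contraR => /(rdim_vertex V) ->.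
have cP : vertex Q (s, (n + s)%N).1 && vertex Q (s, (n + s)%N).2 &&
    ((s, (n + s)%N).1 <= (s, (n + s)%N).2)%N.
  by rewrite /= !vertexP ?leq_addl.
exists (Sub (s, n + s)%N cP : proot Q); apply: (interval_summand (i := i) (j := j)) => //.
- move=> t; apply: contraTeq => Vt; rewrite -leqNgt; exact: s_min.
- by apply/eqP; apply: contraT => /n_max; rewrite ltnn.
Qed.

Lemma module_of_surj V : exists cs, isomorphic V (module_of cs).
Proof.
have [N VN] := rdim_finite V.
have [m] := ubnP (\sum_(t < N) V t); elim: m V VN => // m IHm V VN Vm.
have [V0|/existsNP[t /eqP Vt]] := pselect (forall t, V t = 0%N).
  by exists [::]; apply: zero_isomorphic.
have [c [X VX]] := interval_split Vt.
have dimV t' : V t' = (interval_rep k c t' + X t')%N by rewrite (isomorphic_dim VX).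
have [||cs Xcs] := IHm X.
- by move=> t' /VN; rewrite dimV => /eqP; rewrite addn_eq0 => /andP[_ /eqP].
- rewrite ltnS in Vm; apply: leq_trans Vm; under [X in (_ < X)%N]eq_bigr do rewrite dimV.
  rewrite big_split /= -[X in (X < _)%N]add0n ltn_add2r lt0n sum_nat_eq0.
  have [/andP[c0 _] c12] := andP (valP c).
  (* The total dimension drops because the interval has dimension 1 at its left end, which lies
     below [N]. *)
  have c2N : ((val c).1 < N)%N.
    rewrite ltnNge; apply/negP => /VN; rewrite dimV.
    by rewrite /interval_rep /= leqnn c12.
  apply/forallPn; exists (Ordinal c2N).
  by rewrite /= leqnn c12.
- exists (c :: cs); apply: (isomorphic_trans VX).
  by apply: dsum_isomorphic => //; exact: isomorphic_refl.
Qed.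

End Classification.

(** * Isomorphism classes and extension by zero *)

Section Isoclasses.
Variable Q : quiver.
Implicit Types (l : isoclass Q) (c : proot Q).

Definition root_seq l : seq (proot Q) :=
  flatten [seq nseq (l c) c | c <- finsupp l].

Lemma mod_of_root_seq (k : fieldType) l : mod_of k l = module_of k (root_seq l).
Proof.
rewrite /mod_of /module_of /root_seq map_flatten -map_comp.
by congr (foldr _ _ (flatten _)); apply: eq_map => c /=; rewrite map_nseq.
Qed.

Lemma count_root_seq (P : pred (proot Q)) l :
  count P (root_seq l) = (\sum_(c <- finsupp l) P c * l c)%N.
Proof.
rewrite /root_seq count_flatten -map_comp sumnE big_map.
by apply: eq_bigr => c _ /=; rewrite count_nseq.
Qed.

Lemma count_mem_root_seq c l : count_mem c (root_seq l) = l c.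
Proof.
rewrite count_root_seq; have [cl|cl] := boolP (c \in finsupp l); last first.
  rewrite (fsfun_dflt cl).
  rewrite big1_seq // => d /= dl; case: eqP => // dc.
  by rewrite -dc dl in cl.
rewrite (bigD1_seq c) ?fset_uniq //= eqxx mul1n big1 ?addn0 //.
by move=> d /negbTE ->.
Qed.

Definition dimvec l t : nat :=
  count (fun c => ((val c).1 <= t <= (val c).2)%N) (root_seq l).

Lemma mod_of_dim (k : fieldType) l t : mod_of k l t = dimvec l t.
Proof. by rewrite mod_of_root_seq module_of_dim. Qed.

Lemma mod_of_inj (k : fieldType) l l' :
  isomorphic (mod_of k l) (mod_of k l') -> l = l'.
Proof.
rewrite !mod_of_root_seq => /module_of_inj /permP p.
by apply/fsfunP => c; rewrite -!count_mem_root_seq p.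
Qed.

Lemma mod_of_surj (k : fieldType) (V : rep k Q) :
  exists l, isomorphic V (mod_of k l).
Proof.
have [cs Vcs] := module_of_surj V.
exists [fsfun c in [fset c in cs]%fset => count_mem c cs].
apply: (isomorphic_trans Vcs); rewrite mod_of_root_seq; apply: module_of_perm.
apply/allP => c _ /=; rewrite count_mem_root_seq fsfunE /= in_fset /=.
by case: ifP => // /negbT /count_memPn ->.
Qed.

Lemma leq_dimvec l c t : ((val c).1 <= t <= (val c).2)%N -> (l c <= dimvec l t)%N.
Proof.
by move=> ct; rewrite -(count_mem_root_seq c); apply: sub_count => d /= /eqP ->.
Qed.

Lemma dimvec_finite l : exists N, forall t, (N <= t)%N -> dimvec l t = 0%N.
Proof.
(* The dimension vector is combinatorial, so the field here is an arbitrary choice. *)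
have [N lN] := rdim_finite (mod_of rat l).
by exists N => t /lN; rewrite mod_of_dim.
Qed.

Lemma dimvec_vertex l t : ~~ vertex Q t -> dimvec l t = 0%N.
Proof. by move/(rdim_vertex (mod_of rat l)); rewrite mod_of_dim. Qed.

Lemma dimvec_neq0_vertex l t : dimvec l t != 0%N -> vertex Q t.
Proof. by apply: contraR => /dimvec_vertex ->. Qed.

(** The multiplicity of a root is at most the dimension at any of its vertices, hence at most [D],
    and no root reaching [N] occurs. So [l] is encoded by a finite table of bounded numbers. *)
Lemma finite_dimvec (d : nat -> nat) N : (forall t, (N <= t)%N -> d t = 0%N) ->
  finite_set [set l | dimvec l =1 d].
Proof.
move=> dN; set S := mkset _.
pose D := (\max_(t < N) d t)%N.
have d_le t : (d t <= D)%N.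
  have [tN|/dN ->//] := ltnP t N.
  exact: (leq_bigmax (Ordinal tN)).
pose at_ l (ij : 'I_N * 'I_N) : nat :=
  odflt 0%N (omap l (insub (val ij.1, val ij.2))).
pose r l : {ffun 'I_N * 'I_N -> 'I_D.+1} := [ffun ij => inord (at_ l ij)].
have rE l ij : S l -> r l ij = at_ l ij :> nat.
  move=> lS; rewrite ffunE inordK // ltnS /at_; case: insubP => //= c _ cE.
  apply: leq_trans (d_le (val c).1); rewrite -lS; apply: leq_dimvec.
  by rewrite leqnn; case/andP: (valP c).
have r_inj : {in S &, injective r}.
  move=> l l' /[!inE] lS lS' e; apply/fsfunP => c.
  have [c0 c12] := andP (valP c).
  have [cN|Nc] := ltnP (val c).2 N; last first.
    have c_le l'' : S l'' -> l'' c = 0%N.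
      move=> lS''; have := lS'' (val c).2; rewrite dN // => d0.
      apply/eqP; rewrite -leqn0 -[X in (_ <= X)%N]d0.
      by rewrite leq_dimvec // c12 leqnn.
    by rewrite !c_le.
  pose ij := (Ordinal (leq_ltn_trans c12 cN), Ordinal cN).
  have := rE l ij lS; rewrite e rE // /at_ /=.
  by rewrite -surjective_pairing valK.
have rfin : finite_set (r @` S) by exact: finite_finset.
by rewrite -(eq_finite_set (inj_card_eq r_inj)).
Qed.

Lemma finite_extensions l l' :
  finite_set [set l'' | dimvec l'' =1 (fun t => dimvec l t + dimvec l' t)%N].
Proof.
have [[N lN] [N' lN']] := (dimvec_finite l, dimvec_finite l').
apply: (@finite_dimvec _ (maxn N N')) => t.
by rewrite geq_max => /andP[/lN -> /lN' ->].
Qed.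

Lemma dimvec0 t : dimvec [fsfun] t = 0%N.
Proof. by rewrite /dimvec /root_seq finsupp0. Qed.

End Isoclasses.

Lemma extendE Q Q' (l : isoclass Q) (c : proot Q') :
  extend Q' l c = odflt 0%N (omap l (insub (val c))).
Proof.
rewrite fsfunE in_fset /=; case: ifP => // /negbT.
rewrite mem_pmap; case: insubP => // d _ dE cl.
apply/esym/eqP; apply: contraNT cl; rewrite /= -mem_finsupp => dl.
by apply/mapP; exists (val d); [rewrite map_f | rewrite dE valK].
Qed.

Section Extension.
Variables Q Q' : quiver.

(** Here [extend Q] acts as restriction to the roots of [Q]. Both ends of a root of nonzero
    multiplicity lie in the support of the dimension vector, so no multiplicity is lost. *)
Lemma extendK (l : isoclass Q') :
  (forall t, dimvec l t != 0%N -> vertex Q t) -> extend Q' (extend Q l) = l.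
Proof.
move=> lQ; apply/fsfunP => c; rewrite extendE; have [c0 c12] := andP (valP c).
case: insubP => [d _ dE|]; first by rewrite [LHS]/= extendE dE valK.
rewrite /=.
rewrite c12 andbT; apply: contraNeq; rewrite eq_sym -lt0n => lc.
by rewrite !lQ // -lt0n (leq_trans lc) // leq_dimvec // leqnn c12.
Qed.

Lemma extend0 : extend Q' ([fsfun] : isoclass Q) = [fsfun].
Proof.
by apply/fsfunP => c; rewrite extendE !fsfunE; case: insubP => //= d; rewrite fsfunE.
Qed.

Hypothesis sub : forall t, vertex Q t -> vertex Q' t.

Lemma root_incl_subproof (c : proot Q) :
  vertex Q' (val c).1 && vertex Q' (val c).2 && ((val c).1 <= (val c).2)%N.
Proof. by have /andP[/andP[/sub -> /sub ->] ->] := valP c. Qed.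

Definition root_incl (c : proot Q) : proot Q' := Sub (val c) (root_incl_subproof c).

Lemma root_seq_extend (l : isoclass Q) :
  perm_eq (root_seq (extend Q' l)) [seq root_incl c | c <- root_seq l].
Proof.
apply/allP => c _ /=; rewrite count_mem_root_seq extendE count_map.
case: insubP => /= [d _ dE|cQ].
  by rewrite -(count_mem_root_seq d); apply/eqP/eq_count => x /=; rewrite -!val_eqE /= dE.
apply/eqP/esym; rewrite -[RHS](count_pred0 (root_seq l)); apply: eq_count => d /=.
by apply: contraNF cQ => /eqP <-; apply: (valP d).
Qed.

Lemma dimvec_extend (l : isoclass Q) : dimvec (extend Q' l) =1 dimvec l.
Proof.
move=> t; rewrite /dimvec (permP (root_seq_extend l)) count_map.
exact: eq_count.
Qed.

Lemma extend_inj : injective (@extend Q Q').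
Proof.
move=> l l' e; apply/fsfunP => c.
have := congr1 (fun x : isoclass Q' => x (root_incl c)) e.
by rewrite /= !extendE /= valK.
Qed.

Section Representations.
Variable k : fieldType.

Lemma rep_incl_subproof (V : rep k Q) t : ~~ vertex Q' t -> V t = 0%N.
Proof. by move=> tQ'; apply: rdim_vertex; apply: contraNN tQ' => /sub. Qed.

Definition rep_incl (V : rep k Q) : rep k Q' :=
  Rep (@arrow k Q V) (rep_incl_subproof V) (rdim_finite V).

Lemma mod_of_extend l :
  isomorphic (mod_of k (extend Q' l)) (rep_incl (mod_of k l)).
Proof.
rewrite !mod_of_root_seq; apply: isomorphic_trans (module_of_perm k (root_seq_extend l)) _.
elim: (root_seq l) => [|c s IHs]; first exact: zero_isomorphic.
apply: (@isomorphic_trans _ _ _ (dsum (rep_incl (interval_rep k c))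
   (rep_incl (module_of k s)))); last exact: isomorphic_refl.
by apply: dsum_isomorphic => //; exact: isomorphic_refl.
Qed.

End Representations.

(** True by computation: spaces are indexed by all natural numbers, so [rep_incl] keeps the very
    same spaces and arrows, and Hall numbers see nothing else. *)
Lemma hall_number_rep_incl (k : finFieldType) (V A B : rep k Q) :
  hall_number (rep_incl V) (rep_incl A) (rep_incl B) = hall_number V A B.
Proof. by []. Qed.

Lemma hall_number_extend (k : finFieldType) (a b l : isoclass Q) :
  hall_number (mod_of k (extend Q' l)) (mod_of k (extend Q' a))
    (mod_of k (extend Q' b)) = hall_number (mod_of k l) (mod_of k a) (mod_of k b).
Proof.
rewrite -hall_number_rep_incl; apply: hall_number_iso; exact: mod_of_extend.
Qed.

End Extension.

Lemma hall_polynomialE (k : finFieldType) Q (a b l : isoclass Q) f :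
  hall_polynomial a b l f ->
  f.[#|k|%:Z] = (hall_number (mod_of k l) (mod_of k a) (mod_of k b))%:Z.
Proof.
move=> /(_ k)[n]; rewrite hall_setE => /card_eq_count nE ->.
by rewrite -nE.
Qed.

(** * The Euler form *)

Section EulerForm.
Variable k : fieldType.

(** * Graded maps as row vectors *)

Section Encoding.
Variables (m n : nat -> nat) (N : nat).
Hypothesis mN : forall t, (N <= t)%N -> m t = 0%N.

Local Notation fam := (forall t, 'M[k]_(m t, n t)).
Local Notation E := 'rV[k]_(\sum_(t < N) m t * n t)%N.

(** Families over all vertices are concatenated, up to a bound of the support, into one row vector,
    so that the dimension theory of subspaces applies to them. *)
Definition enc (x : fam) : E := \mxrow_(t < N) mxvec (x t).

Definition dec (v : E) : fam := fun t =>
  if ltnP t N is LtnNotGeq tN then vec_mx (submxrow v (Ordinal tN)) else 0.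

Lemma decK v : enc (dec v) = v.
Proof.
rewrite -[RHS]submxrowK; apply: eq_mxrow => i; rewrite /dec.
case: ltnP (ltn_ord i) => // iN _; rewrite vec_mxK.
by case: i iN => i li iN; rewrite (bool_irrelevance iN li).
Qed.

Lemma encK x : dec (enc x) = x.
Proof.
apply: functional_extensionality_dep => t; rewrite /dec.
case: ltnP => [tN|/mN mt]; first by rewrite mxrowK mxvecK.
by move: (x t); rewrite mt => y; rewrite [y]flatmx0.
Qed.

Lemma enc_linear a x y :
  enc (fun t => a *: x t + y t) = a *: enc x + enc y.
Proof.
have sub_lin (u v : E) i :
    submxrow (a *: u + v) i = a *: submxrow u i + submxrow v i.
  by apply/rowP => j; rewrite !mxE.
by apply/mxrowP => i; rewrite sub_lin !mxrowK linearP.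
Qed.

Lemma enc_sub_sum d (h : fam) (c : 'I_d -> k) (b : 'I_d -> fam) :
  enc (fun t => h t - \sum_j c j *: b j t) = enc h - \sum_j c j *: enc (b j).
Proof.
have -> : (fun t => h t - \sum_j c j *: b j t) =
    fun t => (-1) *: (\sum_j c j *: b j t) + h t.
  by apply: functional_extensionality_dep => t; rewrite scaleN1r addrC.
rewrite enc_linear scaleN1r addrC; congr (_ - _).
elim: (index_enum 'I_d) => [|j r IHr].
  rewrite big_nil; apply/mxrowP => i; rewrite mxrowK big_nil linear0.
  by apply/rowP => j; rewrite !mxE.
rewrite big_cons -IHr -enc_linear; congr enc.
by apply: functional_extensionality_dep => t; rewrite big_cons.
Qed.

Lemma enc_dim : \dim {: E} = (\sum_(t < N) m t * n t)%N.
Proof. by rewrite dimvf /dim /= mul1n. Qed.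

End Encoding.

Section LinearMap.
Variables (m n m' n' : nat -> nat) (N : nat).
Hypothesis mN : forall t, (N <= t)%N -> m t = 0%N.

Variable phi : (forall t, 'M[k]_(m t, n t)) -> forall t, 'M[k]_(m' t, n' t).
Hypothesis phi_lin : forall a (x y : forall t, 'M[k]_(m t, n t)),
  phi (fun t => a *: x t + y t) = fun t => a *: phi x t + phi y t.

Definition encfun (v : 'rV[k]_(\sum_(t < N) m t * n t)%N) := enc N (phi (dec v)).

Lemma encfun_linear : linear encfun.
Proof.
move=> a u v; rewrite -[u in LHS]decK -[v in LHS]decK -enc_linear.
by rewrite /encfun encK // phi_lin enc_linear.
Qed.

HB.instance Definition _ := GRing.isLinear.Build k 'rV[k]_(\sum_(t < N) m t * n t)%N
  'rV[k]_(\sum_(t < N) m' t * n' t)%N _ encfun encfun_linear.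

Definition enchom := linfun encfun.

Lemma enchomE x : enchom (enc N x) = enc N (phi x).
Proof. by rewrite lfunE /= /encfun encK. Qed.

End LinearMap.


Variable Q : quiver.
Implicit Types V W I C : rep k Q.

(** * Quotient dimensions, Hom and Ext *)

Section HasDim.
Variables (V W : rep k Q) (E : vectType k).
Variables (code : graded_map V W -> E) (decode : E -> graded_map V W).
Hypothesis decodeK : cancel decode code.
Hypothesis code_sub_sum : forall d h (c : 'I_d -> k) b,
  code (fun t => h t - \sum_j c j *: b j t) = code h - \sum_j c j *: code (b j).

(** A family witnessing [has_dim] is the same as a basis of a complement of [T'] in [S']; conversely
    [S' :\: T'] provides such a basis. *)
Lemma has_dimP (S T : set (graded_map V W)) (S' T' : {vspace E}) d :
  (forall h, S h <-> code h \in S') -> (forall h, T h <-> code h \in T') ->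
  (T' <= S')%VS ->
  has_dim S T d <-> (d + \dim T')%N = \dim S'.
Proof.
move=> SE TE TS; split=> [[b [bS b_uniq]]|dE].
  pose X := [tuple code (b j) | j < d].
  have XE (c : 'rV[k]_d) : \sum_j c 0 j *: code (b j) = \sum_j c 0 j *: X`_j.
    by apply: eq_bigr => j _; rewrite -tnth_nth tnth_mktuple.
  have coef (c : 'rV[k]_d) : \sum_j c 0 j *: X`_j \in T' -> c = 0.
    (* Independence modulo [T'] is the uniqueness of coefficients for the zero vector: both [c] and
       0 represent it. *)
    move=> cT; have /b_uniq[c0 [_ c0_uniq]] :
        S (decode 0).
      by apply/SE; rewrite decodeK mem0v.
    transitivity c0; [apply/esym|]; apply: c0_uniq; apply/TE;
      rewrite code_sub_sum decodeK.
      by rewrite XE sub0r memvN.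
    rewrite [\sum_(j < d) _]big1 ?subr0 ?mem0v // => j _.
    by rewrite mxE scale0r.
  have Xfree : free X.
    apply/freeP => a a0 j; have := coef (\row_j a j).
    under eq_bigr do rewrite mxE.
    by rewrite a0 mem0v => /(_ isT)/rowP/(_ j); rewrite !mxE.
  have XT : (<<X>> :&: T' = 0)%VS.
    apply/eqP; rewrite -subv0; apply/subvP => x /memv_capP[xX xT].
    move: xT; rewrite memv0 [x in x \in T'](coord_span xX) => xT.
    rewrite (coord_span xX).
    have := coef (\row_j coord X j x).
    under eq_bigr do rewrite mxE.
    move=> /(_ xT)/rowP c0; rewrite big1 // => j _.
    by have := c0 j; rewrite !mxE => ->; rewrite scale0r.
  have <-: (<<X>> + T' = S')%VS.
    apply/eqP; rewrite eqEsubv subv_add TS andbT; apply/andP; split.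
      apply/span_subvP => x /tnthP[j ->]; rewrite tnth_mktuple; exact/SE.
    apply/subvP => x xS.
    have /b_uniq[c [cT _]] : S (decode x) by apply/SE; rewrite decodeK.
    move/TE: cT; rewrite code_sub_sum decodeK XE => cT.
    rewrite -[x](subrK (\sum_j c 0 j *: X`_j)) addrC memv_add //.
    by apply: memv_suml => j _; rewrite memvZ // memv_span // mem_nth ?size_tuple.
  by rewrite dimv_disjoint_sum // (eqP Xfree) size_tuple.
have dD : \dim (S' :\: T') = d.
  apply/eqP; rewrite -(eqn_add2r (\dim T')) dE -dimv_disjoint_sum ?capv_diff //.
  by rewrite addv_diff (addv_idPl TS).
pose X := vbasis (S' :\: T')%VS.
have Xbasis : basis_of (S' :\: T')%VS X := vbasisP _.
rewrite -dD in X Xbasis *.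
exists (fun j => decode X`_j).
have XE (c : 'rV[k]_(\dim (S' :\: T'))) :
    \sum_j c 0 j *: code (decode X`_j) = \sum_j c 0 j *: X`_j.
  by apply: eq_bigr => j _; rewrite decodeK.
have memX (c : 'rV[k]_(\dim (S' :\: T'))) : \sum_j c 0 j *: X`_j \in (S' :\: T')%VS.
  apply: memv_suml => j _; rewrite memvZ // (basis_mem Xbasis) // mem_nth //.
  by rewrite size_tuple.
split=> [j|h /SE hS].
  apply/SE; rewrite decodeK; apply: (subvP (diffvSl S' T')).
  by rewrite (basis_mem Xbasis) // mem_nth // size_tuple.
have : code h \in (S' :\: T' + T')%VS by rewrite addv_diff (addv_idPl TS).
case/memv_addP => x xD [y yT hE].
exists (\row_j coord X j x); split=> [|c cT].
  apply/TE; rewrite code_sub_sum XE.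
  under eq_bigr do rewrite mxE.
  by rewrite -(coord_basis Xbasis xD) hE addrC addKr.
move/TE: cT; rewrite code_sub_sum XE hE => cT.
have x0 : x - \sum_j c 0 j *: X`_j \in ((S' :\: T') :&: T')%VS.
  rewrite memv_cap rpredB ?memX //= -(addrK y (x - _)) rpredB //.
  by rewrite addrAC.
move: x0; rewrite capv_diff memv0 subr_eq0 => /eqP xE.
apply/rowP => j; rewrite mxE xE coord_sum_free //.
exact: basis_free Xbasis.
Qed.

End HasDim.


Lemma enc_eq0 m n N (x : forall t, 'M[k]_(m t, n t)) :
  (forall t, (N <= t)%N -> m t = 0%N) -> enc N x = 0 <-> forall t, x t = 0.
Proof.
move=> mN; split=> [x0 t|x0].
  rewrite -(encK mN x) x0 /dec; case: ltnP => // tN.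
  by apply/matrixP => i j; rewrite !mxE.
apply/mxrowP => i; rewrite mxrowK x0 linear0.
by apply/rowP => j; rewrite !mxE.
Qed.

(** The differential of the standard two-term complex, with kernel Hom(V, W) and cokernel Ext^1(V,
    W). *)
Definition delta V W (h : graded_map V W) t : 'M[k]_(V t, W t.+1) :=
  h t *m arrow W t - arrow V t *m h t.+1.

Lemma delta_linear V W a (x y : graded_map V W) :
  delta (fun t => a *: x t + y t) = fun t => a *: delta x t + delta y t.
Proof.
apply: functional_extensionality_dep => t; rewrite /delta.
rewrite mulmxDl mulmxDr -scalemxAl -scalemxAr scalerBr.
by rewrite opprD addrACA.
Qed.

Lemma hom_delta V W (h : graded_map V W) : hom h <-> forall t, delta h t = 0.
Proof.
split=> hh t; first by rewrite /delta hh subrr.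
by apply/esym/eqP; rewrite -subr_eq0; apply/eqP/hh.
Qed.

Definition mulr_family V W X (g : graded_map W X) (h : graded_map V W) :
  graded_map V X := fun t => h t *m g t.

Lemma mulr_family_linear V W X (g : graded_map W X) a (x y : graded_map V W) :
  mulr_family g (fun t => a *: x t + y t) =
  fun t => a *: mulr_family g x t + mulr_family g y t.
Proof.
apply: functional_extensionality_dep => t; rewrite /mulr_family.
by rewrite mulmxDl -scalemxAl.
Qed.

Lemma delta_mulr V W X (g : graded_map W X) (h : graded_map V W) t :
  hom g -> delta (mulr_family g h) t = delta h t *m g t.+1.
Proof.
by move=> gh; rewrite /delta /mulr_family mulmxBl -!mulmxA gh.
Qed.

(* Injectivity is applied to the extension of V by I glued along phi: a
   retraction onto I is a preimage of phi under delta. *)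
Lemma injective_delta V I (phi : forall t, 'M[k]_(V t, I t.+1)) :
  injective_rep I -> exists h : graded_map V I, delta h = phi.
Proof.
move=> Iinj.
pose X := @Rep k Q (fun t => I t + V t)%N
  (fun t => block_mx (arrow I t) 0 (phi t) (arrow V t))
  (dsum_vertex I V) (dsum_finite I V).
pose f (t : nat) : 'M[k]_(I t, X t) := row_mx 1%:M 0.
have [||h hh fh] := Iinj I X f (fun=> 1%:M).
- split=> t.
    by rewrite /f /= mul_row_block !(mul0mx, mul1mx) !addr0 mul_mx_row mulmx1 mulmx0.
  by apply/row_freeP; exists (col_mx 1%:M 0); rewrite mul_row_col mulmx1 mulmx0 addr0.
- by move=> t; rewrite mulmx1 mul1mx.
exists (fun t => dsubmx (h t : 'M_(I t + V t, I t))).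
apply: functional_extensionality_dep => t; rewrite /delta.
have uh t' : usubmx (h t' : 'M_(I t' + V t', I t')) = 1%:M.
  by have := fh t'; rewrite /f -[h t']vsubmxK mul_row_col mul1mx mul0mx addr0 col_mxKu.
have := hh t; rewrite -[h t]vsubmxK -[h t.+1]vsubmxK !uh /=.
rewrite mul_block_col mul_col_mx => /(congr1 dsubmx).
rewrite !col_mxKd mulmx1 => <-.
by rewrite addrK.
Qed.

Section DimensionCount.
Variables (V : rep k Q) (N : nat).
Hypothesis VN : forall t, (N <= t)%N -> V t = 0%N.

Definition dimC (n : nat -> nat) := (\sum_(t < N) V t * n t)%N.

Local Notation Delta W := (enchom N (@delta V W)).

Lemma lker_delta W (h : graded_map V W) :
  hom h <-> enc N h \in lker (Delta W).
Proof.
rewrite memv_ker enchomE //; last exact: delta_linear.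
by rewrite hom_delta -(enc_eq0 _ VN); split=> [->|/eqP].
Qed.

Lemma dim_lker_delta W :
  (forall phi, exists h : graded_map V W, delta h = phi) ->
  (\dim (lker (Delta W)) + dimC (fun t => W t.+1))%N = dimC W.
Proof.
move=> surj; have imE : (Delta W @: fullv)%VS = fullv.
  apply/eqP; rewrite eqEsubv subvf; apply/subvP => v _.
  have [h hE] := surj (dec v).
  apply/memv_imgP; exists (enc N h); rewrite ?memvf // enchomE ?hE ?decK //.
  exact: delta_linear.
have := limg_ker_dim (Delta W) fullv; rewrite capfv imE enc_dim => e.
rewrite /dimC -[RHS]e; congr (_ + _)%N; apply/esym.
exact: (enc_dim V (fun t => W t.+1) N).
Qed.

Lemma has_dim_enc W (S T : set (graded_map V W))
    (S' T' : {vspace 'rV[k]_(\sum_(t < N) V t * W t)%N}) d :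
  (forall h, S h <-> enc N h \in S') -> (forall h, T h <-> enc N h \in T') ->
  (T' <= S')%VS -> has_dim S T d <-> (d + \dim T')%N = \dim S'.
Proof.
by apply: has_dimP; [exact: decK | move=> *; exact: enc_sub_sum].
Qed.

Lemma dim_homE W : dim_hom V W = \dim (lker (Delta W)).
Proof.
have dimP d : has_dim (@hom _ _ V W) [set h | forall t, h t = 0] d <->
    d = \dim (lker (Delta W)).
  rewrite (has_dim_enc (S' := lker (Delta W)) (T' := 0%VS)) ?sub0v ?dimv0 ?addn0 //.
    by move=> h; exact: lker_delta.
  by move=> h /=; rewrite memv0 -(enc_eq0 _ VN); split=> [->|/eqP].
rewrite /dim_hom; case: xgetP => [d _ /dimP //|no].
by have /= := no (\dim (lker (Delta W))); case; apply/dimP.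
Qed.

(** The rank of [delta] is at most the dimension of its target. This keeps the natural-number
    subtraction that gives the dimension of Ext^1 from being truncated. *)
Lemma leq_dimC W : (dimC W <= dim_hom V W + dimC (fun t => W t.+1))%N.
Proof.
have := limg_ker_dim (Delta W) fullv; rewrite capfv enc_dim => e.
rewrite dim_homE /dimC -[X in (X <= _)%N]e leq_add2l.
apply: leq_trans (dimvS (subvf _)) _.
by rewrite (enc_dim V (fun t => W t.+1) N).
Qed.

(** As [delta] is onto for [I] and [C], dimension vectors alone determine dim Hom(V, I) and dim
    Hom(V, C). The exact sequence 0 -> Hom(V, W) -> Hom(V, I) -> Hom(V, C) then gives the dimension
    of the cokernel. *)
Lemma has_dim_ext W I C (f : graded_map W I) (g : graded_map I C) d :
  injective_rep I -> short_exact f g ->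
  has_dim (@hom _ _ V C) [set h | exists2 l, @hom _ _ V I l &
     forall t, h t = l t *m g t] d <->
  (d + dimC W = dim_hom V W + dimC (fun t => W t.+1))%N.
Proof.
move=> Iinj [[fh ffree] gh gfull fg].
pose F := enchom N (@mulr_family V W I f).
pose G := enchom N (@mulr_family V I C g).
have FE h : F (enc N h) = enc N (mulr_family f h).
  by apply: enchomE => //; exact: mulr_family_linear.
have GE h : G (enc N h) = enc N (mulr_family g h).
  by apply: enchomE => //; exact: mulr_family_linear.
have Isurj phi : exists h : graded_map V I, delta h = phi.
  exact: injective_delta.
(* Lift [phi] through the epimorphism [g] at each vertex, solve in [I], and push the solution down
   to [C]. *)
have Csurj (phi : forall t, 'M[k]_(V t, C t.+1)) :
    exists h : graded_map V C, delta h = phi.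
  have [h hE] := Isurj (fun t => phi t *m pinvmx (g t.+1)).
  exists (mulr_family g h); apply: functional_extensionality_dep => t.
  by rewrite delta_mulr // hE -mulmxA mulVpmx ?mulmx1.
have dimI t : I t = (W t + C t)%N.
  have := mxrank_ker (g t); rewrite -(fg t).
  have /eqP -> := ffree t; have /eqP -> := gfull t.
  by have := rank_leq_row (g t); have /eqP -> := gfull t; lia.
rewrite (has_dim_enc (S' := lker (Delta C)) (T' := (G @: lker (Delta I))%VS)); first last.
- apply/subvP => _ /memv_imgP[x xI ->].
  rewrite -[x]decK GE -lker_delta => t.
  have: hom (dec x : graded_map V I) by apply/lker_delta; rewrite decK.
  by move=> xh; rewrite /mulr_family -!mulmxA -gh !mulmxA xh.
- move=> h; split=> [[l lh hE]|/memv_imgP[x xI xE]].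
    apply/memv_imgP; exists (enc N l); first exact/lker_delta.
    by rewrite GE; congr enc; apply: functional_extensionality_dep.
  exists (dec x); first by apply/lker_delta; rewrite decK.
  move: xE; rewrite -[x in G x]decK GE => /(congr1 (@dec V C N)).
  by rewrite !encK // => ->.
- exact: lker_delta.
have GI := limg_ker_dim G (lker (Delta I)).
have F0 : (lker (Delta W) :&: lker F = 0)%VS.
  apply/eqP; rewrite -subv0; apply/subvP => x /memv_capP[_].
  rewrite memv_ker -[x]decK FE memv0 => /eqP/enc_eq0 xf0.
  apply/eqP/enc_eq0 => // t; apply: (row_free_inj (ffree t)).
  by rewrite mul0mx; apply: xf0.
have FW := limg_ker_dim F (lker (Delta W)).
rewrite F0 dimv0 add0n in FW.
(* Left exactness of Hom(V, -): a morphism killed by [g] factors through [f] at each vertex, and the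
   factor is a morphism because [f] is mono. *)
have FG : (F @: lker (Delta W) = lker (Delta I) :&: lker G)%VS.
  apply/eqP; rewrite eqEsubv; apply/andP; split; apply/subvP.
    move=> _ /memv_imgP[x xW ->]; rewrite -[x]decK FE memv_cap.
    apply/andP; split.
      apply/lker_delta/hom_delta => t; rewrite delta_mulr //.
      have : hom (dec x : graded_map V W) by apply/lker_delta; rewrite decK.
      by move/hom_delta => ->; rewrite mul0mx.
    rewrite memv_ker GE; apply/eqP/enc_eq0 => // t; rewrite /mulr_family -mulmxA.
    rewrite (_ : f t *m g t = 0) ?mulmx0 //.
    by apply/eqP; rewrite -sub_kermx -fg.
  move=> x /memv_capP[xI]; rewrite memv_ker -[x]decK GE => /eqP/enc_eq0 xg0.
  have xh : hom (dec x : graded_map V I) by apply/lker_delta; rewrite decK.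
  have xf t : dec x t *m pinvmx (f t) *m f t = dec x t.
    by rewrite mulmxKpV // fg sub_kermx; apply/eqP; apply: xg0.
  apply/memv_imgP; exists (enc N (fun t => dec x t *m pinvmx (f t))); last first.
    by rewrite FE; congr enc; apply: functional_extensionality_dep => t; rewrite -xf.
  apply/lker_delta => t; apply: (row_free_inj (ffree t.+1)) => /=.
  by rewrite -mulmxA xf xh -[RHS]mulmxA fh mulmxA xf.
have dimCI (x y z : nat -> nat) : (forall t, x t = y t + z t)%N ->
    dimC x = (dimC y + dimC z)%N.
  by move=> e; rewrite /dimC -big_split; apply: eq_bigr => t _; rewrite e mulnDr.
have := dimCI I W C dimI.
have := dimCI (fun t => I t.+1) (fun t => W t.+1) (fun t => C t.+1)
  (fun t => dimI t.+1).
have := dim_lker_delta Isurj; have := dim_lker_delta Csurj.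
rewrite FG in FW; rewrite dim_homE; move: GI FW.
move: (\dim (_ :&: _)) (\dim (_ @: _)) (\dim (lker (Delta I))).
by move: (\dim (lker (Delta C))) (\dim (lker (Delta W))); lia.
Qed.

End DimensionCount.


(** * Existence of injective resolutions *)

Lemma downward_choice (T : nat -> Type) (R : forall t, T t -> T t.+1 -> Prop) N :
  (forall t, T t) -> (forall t x y, (N <= t)%N -> R t x y) ->
  (forall t y, exists x, R t x y) -> exists f, forall t, R t (f t) (f t.+1).
Proof.
move=> x0 RN step.
have [f fR] : exists f : forall t, T t,
    forall t, (N - N <= t)%N -> R t (f t) (f t.+1).
  (* Induction on the distance from [N]: stage [j] satisfies the relation from [N - j] on, and the
     next stage changes [f] at a single vertex. *)
  elim: {2}N => [|j [f fR]]; first by exists x0 => t; rewrite subn0; apply: RN.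
  pose s := (N - j.+1)%N; have [x xR] := step s (f s.+1).
  exists (eqtype.dfwith f x) => t; rewrite -/s leq_eqVlt => /orP[/eqP <-|st].
    by rewrite eqtype.dfwith_in eqtype.dfwith_out // ltn_eqF.
  by rewrite !eqtype.dfwith_out ?ltn_eqF ?ltnS ?(ltnW st) //; apply: fR; lia.
by exists f => t; apply: fR; rewrite subnn.
Qed.

(** The extension is built downwards from beyond the support of [W]. At [t] an arbitrary extension
    of [g t] along [f t] is corrected so as to commute with the value already chosen at [t.+1]. *)
Lemma surjective_injective I :
  (forall t, vertex Q t -> row_full (arrow I t)) -> injective_rep I.
Proof.
move=> Ifull V W f g [fh ffree] gh.
have [N WN] := rdim_finite W.
pose T t := {h : 'M[k]_(W t, I t) | f t *m h == g t}.
have [|||h hR] := @downward_choice T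
    (fun t x y => arrow W t *m val y = val x *m arrow I t) N.
- move=> t; exists (pinvmx (f t) *m g t).
  by rewrite mulmxA mulmxVp ?mul1mx.
- by move=> t x y /WN Wt; move: (arrow W t) (val x); rewrite Wt => a b; rewrite !flatmx0.
- move=> t [y /eqP yP] /=; have fV : f t *m (pinvmx (f t) *m g t) = g t.
    by rewrite mulmxA mulmxVp ?mul1mx.
  have [tQ|tQ] := boolP (vertex Q t); last first.
    exists (exist (fun h => f t *m h == g t) _ (introT eqP fV)).
    by move: (arrow W t) (val _); rewrite rdim_vertex // => a b; rewrite !flatmx0.
  (* The failure to commute vanishes on the image of [f t], so lifting it through the surjective
     arrow of [I] does not disturb the extension property. *)
  pose err := arrow W t *m y - pinvmx (f t) *m g t *m arrow I t.
  have ferr : f t *m err = 0.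
    rewrite mulmxBr (mulmxA (f t) (arrow W t)) -fh -(mulmxA (arrow V t)) yP gh.
    by rewrite (mulmxA (f t) (pinvmx (f t) *m g t)) fV subrr.
  have sP : f t *m (pinvmx (f t) *m g t + err *m pinvmx (arrow I t)) == g t.
    by rewrite mulmxDr fV mulmxA ferr mul0mx addr0.
  exists (exist (fun h => f t *m h == g t) _ sP) => /=.
  by rewrite mulmxDl -[err *m _ *m _]mulmxA mulVpmx ?Ifull // mulmx1 addrC subrK.
- by exists (fun t => val (h t)) => [t|t]; [exact: hR | exact/eqP/(valP (h t))].
Qed.

(** The truncation prescribes the first [m] coordinates; an identity block in the next [w] makes the
    map injective. *)
Lemma row_free_extension w m n (A : 'M[k]_(w, m)) : (m + w <= n)%N ->
  exists x : 'M_(w, n), x *m (pid_mx m : 'M_(n, m)) = A /\ row_free x.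
Proof.
move/subnKC; move: (n - _)%N => r <-; rewrite -addnA.
exists (row_mx A (row_mx 1%:M 0)); split.
  by rewrite pid_mx_col mul_row_col mulmx1 mulmx0 addr0.
apply/row_freeP; exists (col_mx 0 (col_mx 1%:M 0)).
by rewrite !mul_row_col mulmx0 mulmx1 add0r mul0mx addr0.
Qed.

(* The injective representation is k^(D (N - t)) at the vertex t, with the
   truncations as arrows; D and N bound the dimensions and the support of W. *)
Lemma injective_hull W : exists I (f : graded_map W I),
  injective_rep I /\ mono f.
Proof.
have [N WN] := rdim_finite W.
pose D := (\max_(t < N) W t)%N.
have WD t : (t < N)%N -> (W t <= D)%N by move=> tN; exact: (leq_bigmax (Ordinal tN)).
pose e t := (if vertex Q t then D * (N - t) else 0)%N.
have eN t : ~~ vertex Q t -> e t = 0%N by rewrite /e => /negbTE ->.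
have efin : exists n, forall t, (n <= t)%N -> e t = 0%N.
  by exists N => t Nt; rewrite /e (eqP Nt) muln0 if_same.
have eS t : (e t.+1 <= D * (N - t.+1))%N by rewrite /e; case: ifP.
pose I := @Rep k Q e (fun t => pid_mx (e t.+1)) eN efin.
have Ifull t : vertex Q t -> row_full (arrow I t).
  move=> tQ; rewrite /row_full rank_pid_mx //= (leq_trans (eS t)) //.
  by rewrite /e tQ leq_mul2l leq_sub2l ?orbT.
have [|||f fR] := @downward_choice (fun t => 'M[k]_(W t, I t))
    (fun t x y => x *m arrow I t = arrow W t *m y /\ row_free x) N.
- by move=> t; exact: 0.
- move=> t x y /WN Wt; split.
    by move: (arrow W t) x; rewrite Wt => a b; rewrite !flatmx0.
  by apply/eqP; have := rank_leq_row x; lia.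
- move=> t y; have [tQ|tQ] := boolP (vertex Q t); last first.
    exists 0; have Wt := rdim_vertex W tQ; split; last by rewrite /row_free mxrank0 Wt.
    by move: (arrow W t); rewrite Wt => a; rewrite [a]flatmx0 !mul0mx.
  have [Nt|tN] := leqP N t.
    exists 0; have Wt := WN t Nt; split; last by rewrite /row_free mxrank0 Wt.
    by move: (arrow W t); rewrite Wt => a; rewrite [a]flatmx0 !mul0mx.
  (* Passing from [t.+1] down to [t] adds at least [D] coordinates, enough room for [W t]. *)
  apply: row_free_extension; rewrite /= {2}/e tQ.
  apply: leq_trans (leq_add (eS t) (WD t tN)) _.
  by rewrite -{2}[D]muln1 -mulnDr leq_mul2l; apply/orP; right; lia.
- exists I, f; split; first exact: surjective_injective.
  by split=> t; have [] := fR t.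
Qed.

Lemma injective_resolution W : exists I C (f : graded_map W I) (g : graded_map I C),
  injective_rep I /\ short_exact f g.
Proof.
have [I [f [Iinj [fh ffree]]]] := injective_hull W.
pose U t := <<f t>>%MS.
have Ust : is_subrep U.
  move=> t; rewrite (eqmxMr _ (genmxE _)) genmxE -fh; exact: submxMl.
have [g gP] := subquotient_quot Ust.
exists I, (quot_rep U), f, g; split=> //; split=> [//|t|t|t].
- by rewrite -[arrow I t]mul1mx (subquotient_hom gP) ?submx1 // mul1mx.
- by case: gP => _ _ full _; have := full t; rewrite mul1mx.
- apply: eqmx_trans (eqmx_sym (genmxE (f t))) _.
  by case: gP => _ _ _ ker; have := ker t; rewrite cap1mx => /eqmx_sym.
Qed.

Lemma euler_formula V W N : (forall t, (N <= t)%N -> V t = 0%N) ->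
  (dim_hom V W)%:Z - (dim_ext1 V W)%:Z =
  (dimC V N W)%:Z - (dimC V N (fun t => W t.+1))%:Z.
Proof.
move=> VN; suff: (dim_ext1 V W + dimC V N W =
    dim_hom V W + dimC V N (fun t => W t.+1))%N by lia.
(* Every injective resolution leads to the same [d], and one exists, so the default value of [xget]
   is never reached. *)
rewrite /dim_ext1; case: xgetP => [d _ /= [I [C [f [g [Iinj fg]]]]]|no].
  by move/(has_dim_ext VN _ Iinj fg).
have [I [C [f [g [Iinj fg]]]]] := injective_resolution W.
have le := leq_dimC VN W.
case: (no (dim_hom V W + dimC V N (fun t => W t.+1) - dimC V N W)%N) => /=.
by exists I, C, f, g; split=> //; apply/(has_dim_ext VN _ Iinj fg); rewrite subnK.
Qed.

End EulerForm.

(** * Hall polynomials *)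

Lemma primes_above (n m : nat) :
  exists s : seq nat, [/\ size s = n, uniq s, all prime s & all (ltn m) s].
Proof.
elim: n m => [|n IHn] m; first by exists [::].
have [p mp p_prime] := prime_above m; have [s [sn us ps ms]] := IHn p.
exists (p :: s); split=> /=; rewrite ?sn ?us ?p_prime ?mp //=.
  by rewrite andbT; apply/negP => /(allP ms) /=; rewrite ltnn.
by apply: sub_all ms => q /=; exact: ltn_trans.
Qed.

(** The prime fields already supply more cardinalities than a nonzero difference has roots.
    Identities between Hall polynomials are thereby reduced to counting. *)
Lemma poly_eq_finfield (P R : {poly int}) :
  (forall K : finFieldType, P.[#|K|%:Z] = R.[#|K|%:Z]) -> P = R.
Proof.
move=> PR; apply/eqP; rewrite -subr_eq0; apply: contraT => D0.
have [s [sn us ps _]] := primes_above (size (P - R)) 0.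
have := max_poly_roots (rs := [seq Posz p | p <- s]) D0.
rewrite size_map sn ltnn; apply.
  rewrite all_map; apply: sub_all ps => p p_prime /=.
  by rewrite rootE hornerD hornerN -(card_Fp p_prime) PR subrr.
by rewrite map_inj_uniq // => x y [].
Qed.

Section ZeroHallNumbers.
Variables (k : finFieldType) (Q : quiver).
Implicit Types V A B : rep k Q.

Lemma hall_number_zero_quot V A B : (forall t, A t = 0%N) ->
  hall_number V A B = `[<isomorphic V B>].
Proof.
(* A zero quotient forces the subspaces to be everything; this is their canonical form, so the count
   is 0 or 1. *)
move=> A0; pose U1 : family V := fun t => <<1%:M>>%MS.
have U1E t : (U1 t :=: fam1 V t)%MS by exact: genmxE.
have -> : hall_number V A B =
    count (fun U => (U == U1) && `[<isomorphic V B>]) (families V).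
  apply: eq_count => U; apply/asboolP/andP => [[Ucan UB [p pP]]|[/eqP -> /asboolP VB]].
    have UE t : (U t :=: fam1 V t)%MS.
      have := subquotient_dim pP t; rewrite A0 addn0 mxrank1 => rankU.
      by apply/eqmxP; rewrite submx1 sub1mx /row_full rankU eqxx.
    split; last by apply/asboolP/subquotient01; apply: eq_subquotient UB.
    apply/eqP/functional_extensionality_dep => t; rewrite -Ucan.
    exact/eq_genmx/UE.
  split=> [t||]; first exact: genmx_id.
    apply: (eq_subquotient (fun t => eqmx_refl _) (fun t => eqmx_sym (U1E t))).
    exact/subquotient01.
  exists (fun t => 0); split=> t.
  - exact: submx1.
  - by rewrite !mulmx0 mul0mx.
  - by rewrite mulmx0 /row_full mxrank0 A0.
  - by apply/eqmxP; rewrite genmxE submx1 sub_capmx submx1 sub_kermx mulmx0 eqxx.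
case: asboolP => _; last first.
  by rewrite (@eq_count _ _ pred0) ?count_pred0 // => U; rewrite andbF.
rewrite (@eq_count _ _ (pred1 U1)) => [|U]; last by rewrite andbT.
by rewrite count_uniq_mem ?families_uniq // mem_families.
Qed.

Lemma hall_number_zero_sub V A B : (forall t, B t = 0%N) ->
  hall_number V A B = `[<isomorphic V A>].
Proof.
move=> B0; have -> : hall_number V A B =
    count (fun U => (U == fam0 V) && `[<isomorphic V A>]) (families V).
  apply: eq_count => U; apply/asboolP/andP => [[Ucan [p pP] UA]|[/eqP -> /asboolP VA]].
    have UE : U = fam0 V.
      apply: functional_extensionality_dep => t; apply/eqP.
      by rewrite -mxrank_eq0 -(subquotient_dim pP) B0 mxrank0.
    by rewrite UE eqxx in UA *; split=> //; apply/asboolP/subquotient01.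
  split=> [t||]; [exact: genmx0 | | exact/subquotient01].
  exists (fun t => 0); split=> t.
  - by rewrite mul0mx sub0mx.
  - by rewrite !mulmx0 mul0mx.
  - by rewrite mulmx0 /row_full mxrank0 B0.
  - by rewrite cap0mx.
case: asboolP => _; last first.
  by rewrite (@eq_count _ _ pred0) ?count_pred0 // => U; rewrite andbF.
rewrite (@eq_count _ _ (pred1 (fam0 V))) => [|U]; last by rewrite andbT.
by rewrite count_uniq_mem ?families_uniq // mem_families.
Qed.

End ZeroHallNumbers.

(** * The Euler form as a bilinear form in dimension vectors *)

Section Euler.
Variable k : fieldType.

Definition euler_sum N (x y : nat -> nat) : int :=
  \sum_(t < N) ((x t * y t)%:Z - (x t * y t.+1)%:Z).

Lemma eulerE Q (a b : isoclass Q) N : (forall t, (N <= t)%N -> dimvec a t = 0%N) ->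
  euler k a b = euler_sum N (dimvec a) (dimvec b).
Proof.
move=> aN; rewrite /euler (@euler_formula _ _ _ _ N); last first.
  by move=> t /aN; rewrite mod_of_dim.
rewrite /dimC /euler_sum sumrB -!(big_morph Posz PoszD (erefl _)).
by congr (Posz _ - Posz _); apply: eq_bigr => t _; rewrite !mod_of_dim.
Qed.

Lemma eulerDl Q (a b l c : isoclass Q) : dimvec l =1 (fun t => dimvec a t + dimvec b t)%N ->
  euler k l c = euler k a c + euler k b c.
Proof.
move=> lE; have [N lN] := dimvec_finite l.
rewrite !(@eulerE _ _ _ N) // => [|t /lN|t /lN]; rewrite ?lE; try lia.
rewrite -big_split; apply: eq_bigr => t _ /=; rewrite lE; lia.
Qed.

Lemma eulerDr Q (a b l c : isoclass Q) : dimvec l =1 (fun t => dimvec a t + dimvec b t)%N ->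
  euler k c l = euler k c a + euler k c b.
Proof.
move=> lE; have [N cN] := dimvec_finite c.
rewrite !(@eulerE _ _ _ N) //.
rewrite -big_split; apply: eq_bigr => t _ /=; rewrite !lE; lia.
Qed.

Lemma euler_dimvec Q Q' (a b : isoclass Q) (a' b' : isoclass Q') :
  dimvec a =1 dimvec a' -> dimvec b =1 dimvec b' -> euler k a b = euler k a' b'.
Proof.
move=> aa' bb'; have [N aN] := dimvec_finite a.
rewrite !(@eulerE _ _ _ N) // => [|t /aN]; last by rewrite aa'.
by apply: eq_bigr => t _; rewrite aa' !bb'.
Qed.

Lemma euler0l Q (b : isoclass Q) : euler k [fsfun] b = 0.
Proof.
by rewrite (@eulerE _ _ _ 0) => [|t _]; [exact: big_ord0 | exact: dimvec0].
Qed.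

Lemma euler0r Q (a : isoclass Q) : euler k a [fsfun] = 0.
Proof.
have [N aN] := dimvec_finite a; rewrite (@eulerE _ _ _ N) //.
by apply: big1 => t _; rewrite !dimvec0 !muln0.
Qed.
End Euler.

(** * The twisted Hall algebra *)

Section LinearExtension.
Variable K : fieldType.

Lemma fglift_dom (T : choiceType) (M : lmodType K) (f : T -> M) (x : {freeg T / K}) :
  fglift f x = \sum_(z <- dom x) coeff z x *: f z.
Proof. by rewrite -[x in LHS]Freeg_dom fglift_Freeg /prelift big_map. Qed.

Lemma fglift_linear (T : choiceType) (M : lmodType K) (f : T -> M) :
  linear (fglift f : {freeg T / K} -> M).
Proof.
have addB := lift_is_additive f.
have f0 : fglift f 0 = 0 by have := addB 0 0; rewrite !subrr.
move=> c x y; rewrite -[y in LHS]opprK addB -[- y]add0r addB f0 sub0r opprK.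
(* Scaling by zero shrinks the domain of [x], so this case is separate from the comparison of sums
   over equal domains. *)
congr (_ + _); have [->|c0] := eqVneq c 0; first by rewrite !scale0r f0.
rewrite !fglift_dom scaler_sumr (perm_big (dom x)).
  by apply: eq_bigr => z _; rewrite coeffZ scalerA.
by apply: uniq_perm; [exact: uniq_dom | exact: uniq_dom | exact: domZ].
Qed.

Lemma coeff_linear (T : choiceType) (z : T) :
  linear (coeff z : {freeg T / K} -> K^o).
Proof. exact: fglift_linear. Qed.

Lemma fgliftU (T : choiceType) (M : lmodType K) (f : T -> M) z :
  fglift f (<< z >> : {freeg T / K}) = f z.
Proof. by rewrite liftU scale1r. Qed.

Lemma freeg_scaleU (T : choiceType) c (z : T) :
  << c *g z >> = c *: << z >> :> {freeg T / K}.
Proof.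
by apply/eqP/freeg_eqP => y; rewrite coeffZ !coeffU mul1r.
Qed.

Lemma linear_sumZ (M M' : lmodType K) (f : M -> M') I (s : seq I)
    (c : I -> K) (y : I -> M) : linear f ->
  f (\sum_(i <- s) c i *: y i) = \sum_(i <- s) c i *: f (y i).
Proof.
move=> fl; elim: s => [|i s IHs]; last by rewrite !big_cons fl IHs.
by rewrite !big_nil; have := fl (-1) 0 0; rewrite scaleN1r oppr0 addr0 scaleN1r addNr.
Qed.

Lemma linear_comp (M M' M'' : lmodType K) (f : M -> M') (g : M' -> M'') :
  linear f -> linear g -> linear (fun x => g (f x)).
Proof. by move=> fl gl c x y; rewrite fl gl. Qed.

Lemma linear_ext (T : choiceType) (M : lmodType K) (f g : {freeg T / K} -> M) :
  linear f -> linear g -> (forall z, f << z >> = g << z >>) -> f =1 g.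
Proof.
move=> fl gl fg x; rewrite -(freeg_sumE x).
under eq_bigr do rewrite freeg_scaleU.
by rewrite !linear_sumZ //; apply: eq_bigr => z _; rewrite fg.
Qed.
End LinearExtension.

Section HallAlgebra.
Variables (k : fieldType) (F : forall Q : quiver,
  isoclass Q -> isoclass Q -> isoclass Q -> {poly int}).
Hypothesis F_hall : forall (Q : quiver) (a b l : isoclass Q),
  hall_polynomial a b l (F a b l).
Arguments F {Q}.

Local Notation hcoef := (hcoef k F).
Local Notation umul := (umul k F).
Local Notation hmul := (hmul k F).

(** If the dimension vectors do not add up, the Hall number vanishes over every finite field, hence
    so does the polynomial. This makes the sums defining the products finite. *)
Lemma hall_polynomial_dimvec Q (a b l : isoclass Q) : F a b l != 0 ->
  dimvec l =1 (fun t => dimvec a t + dimvec b t)%N.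
Proof.
move=> F0; apply: contrapT => dims; case/eqP: F0.
apply: poly_eq_finfield => K; rewrite (hall_polynomialE K (F_hall a b l)) horner0.
apply/eqP; apply: contraT => n0; case: dims => t.
by rewrite -!(mod_of_dim K) (hall_number_dim n0).
Qed.

Definition extensions Q (a b : isoclass Q) : seq (isoclass Q) :=
  fset_set [set l | dimvec l =1 (fun t => dimvec a t + dimvec b t)%N].

Lemma extensions_uniq Q (a b : isoclass Q) : uniq (extensions a b).
Proof. exact: fset_uniq. Qed.

Lemma mem_extensions Q (a b l : isoclass Q) :
  l \in extensions a b <-> dimvec l =1 (fun t => dimvec a t + dimvec b t)%N.
Proof.
rewrite in_fset_set; last exact: finite_extensions.
by rewrite inE.
Qed.

Lemma hcoef_dimvec Q (a b l : isoclass Q) : hcoef a b l != 0 ->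
  dimvec l =1 (fun t => dimvec a t + dimvec b t)%N.
Proof.
move=> h; apply: hall_polynomial_dimvec; apply: contraNneq h => F0.
by rewrite /Defs.hcoef F0 raddf0 horner0 mulr0.
Qed.

Lemma umulE Q (a b : isoclass Q) (s : seq (isoclass Q)) : uniq s ->
  (forall l, hcoef a b l != 0 -> l \in s) ->
  umul a b = \sum_(l <- s) hcoef a b l *: u l.
Proof.
move=> us sP; rewrite /Defs.umul (fsbigE s) //.
  by apply: eq_bigl => l; rewrite classical_sets.in_setT.
move=> l _ ls; have [->|/sP] := eqVneq (hcoef a b l) 0; first by rewrite scale0r.
by move=> ls'; rewrite ls' in ls.
Qed.

Lemma hmul_u Q (a b : isoclass Q) : hmul (u a) (u b) = umul a b.
Proof. by rewrite /Defs.hmul !fgliftU. Qed.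

Lemma hmul_linearl Q (y : Hrs Q) : linear (hmul^~ y).
Proof. exact: fglift_linear. Qed.

Lemma hmul_linearr Q (x : Hrs Q) : linear (hmul x).
Proof.
move=> c y z; rewrite /Defs.hmul !fglift_dom scaler_sumr -big_split.
apply: eq_bigr => a _ /=.
by rewrite fglift_linear scalerDr !scalerA mulrC.
Qed.

Definition hall_eval (P : {poly int}) : Qrs :=
  (map_poly intr P).[rvar * svar^-1].

Lemma hall_evalM P R : hall_eval (P * R) = hall_eval P * hall_eval R.
Proof. by rewrite /hall_eval rmorphM hornerM. Qed.

Lemma hall_eval_sum (I : Type) (s : seq I) (P : I -> {poly int}) :
  hall_eval (\sum_(i <- s) P i) = \sum_(i <- s) hall_eval (P i).
Proof. by rewrite /hall_eval raddf_sum horner_sum. Qed.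

Lemma svar_neq0 : svar != 0.
Proof. by rewrite /svar tofrac_eq0 polyX_eq0. Qed.

Lemma hall_polynomial_assoc Q (a b c m : isoclass Q) :
  \sum_(l <- extensions a b) F a b l * F l c m =
  \sum_(l <- extensions b c) F b c l * F a l m.
Proof.
apply: poly_eq_finfield => K; rewrite !horner_sum.
under eq_bigr do rewrite hornerM !(hall_polynomialE K (F_hall _ _ _)) -PoszM.
under [RHS]eq_bigr do rewrite hornerM !(hall_polynomialE K (F_hall _ _ _)) -PoszM.
rewrite -!(big_morph Posz PoszD (erefl _)); congr Posz.
have dims (a' b' l : isoclass Q) :
    hall_number (mod_of K l) (mod_of K a') (mod_of K b') != 0%N ->
    l \in extensions a' b'.
  by move=> n0; apply/mem_extensions => t; rewrite -!(mod_of_dim K) (hall_number_dim n0).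
apply: (@hall_number_assoc K Q _ (@mod_of K Q)).
- exact: mod_of_surj.
- exact: mod_of_inj.
- exact: extensions_uniq.
- exact: extensions_uniq.
- by move=> l; apply: dims.
- by move=> l; apply: dims.
Qed.

Lemma hcoef_assoc Q (a b c m : isoclass Q) :
  \sum_(l <- extensions a b) hcoef a b l * hcoef l c m =
  \sum_(l <- extensions b c) hcoef b c l * hcoef a l m.
Proof.
(* The common twist of the two bracketings: for an extension [l], additivity of the Euler form
   splits its pairing with the third factor. *)
pose e := svar ^ (- (euler k a b + euler k a c + euler k b c)).
transitivity (\sum_(l <- extensions a b) e * hall_eval (F a b l * F l c m)).
  apply: eq_big_seq => l /mem_extensions lE.
  rewrite hall_evalM /Defs.hcoef -/(hall_eval _) -/(hall_eval _) mulrACA.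
  by rewrite -expfzDr ?svar_neq0 // (eulerDl _ _ lE) -opprD addrA.
rewrite -mulr_sumr -hall_eval_sum hall_polynomial_assoc hall_eval_sum mulr_sumr.
apply: eq_big_seq => l /mem_extensions lE.
rewrite hall_evalM /Defs.hcoef -/(hall_eval _) -/(hall_eval _) mulrACA.
rewrite -expfzDr ?svar_neq0 // (eulerDr _ _ lE) -opprD; congr (svar ^ (- _) * _).
by rewrite addrC.
Qed.


Lemma hmulA Q : associative (hmul : Hrs Q -> Hrs Q -> Hrs Q).
Proof.
have assoc_u (a b c : isoclass Q) :
    hmul (u a) (hmul (u b) (u c)) = hmul (hmul (u a) (u b)) (u c).
  have fin : finite_set [set m : isoclass Q |
      dimvec m =1 (fun t => dimvec a t + dimvec b t + dimvec c t)%N].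
    have [N aN] := dimvec_finite a; have [N' bN] := dimvec_finite b.
    have [N'' cN] := dimvec_finite c.
    apply: (@finite_dimvec _ _ (N + N' + N'')%N) => t tN.
    by rewrite aN ?bN ?cN //; lia.
  (* One index set for the outer products of both bracketings, whatever the inner class [l] is. *)
  pose S : seq (isoclass Q) := fset_set [set m : isoclass Q |
      dimvec m =1 (fun t => dimvec a t + dimvec b t + dimvec c t)%N].
  have SP m : dimvec m =1 (fun t => dimvec a t + dimvec b t + dimvec c t)%N -> m \in S.
    by move=> mE; rewrite in_fset_set ?inE.
  have uS : uniq S by exact: fset_uniq.
  rewrite !hmul_u (umulE (extensions_uniq b c)); last by move=> l /hcoef_dimvec/mem_extensions.
  rewrite (umulE (extensions_uniq a b)); last by move=> l /hcoef_dimvec/mem_extensions.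
  rewrite (linear_sumZ _ _ _ (hmul_linearr (u a))).
  rewrite (linear_sumZ _ _ _ (hmul_linearl (u c))).
  transitivity (\sum_(m <- S) (\sum_(l <- extensions b c)
      hcoef b c l * hcoef a l m) *: (u m : Hrs Q)).
    under [RHS]eq_bigr do rewrite scaler_suml.
    rewrite exchange_big; apply: eq_big_seq => l /mem_extensions lE.
    rewrite hmul_u (umulE uS) ?scaler_sumr.
      by apply: eq_bigr => m _; rewrite scalerA.
    by move=> m /hcoef_dimvec mE; apply: SP => t; rewrite mE lE addnA.
  under eq_bigr do rewrite -hcoef_assoc scaler_suml.
  rewrite exchange_big; apply: eq_big_seq => l /mem_extensions lE.
  rewrite hmul_u (umulE uS) ?scaler_sumr.
    by apply: eq_bigr => m _; rewrite scalerA.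
  by move=> m /hcoef_dimvec mE; apply: SP => t; rewrite mE lE.
move=> x y z.
apply: (linear_ext (f := fun x => hmul x (hmul y z))
  (g := fun x => hmul (hmul x y) z)) => [||a].
- exact: hmul_linearl.
- exact: linear_comp (hmul_linearl y) (hmul_linearl z).
apply: (linear_ext (f := fun y => hmul (u a) (hmul y z))
  (g := fun y => hmul (hmul (u a) y) z)) => [||b].
- exact: linear_comp (hmul_linearl z) (hmul_linearr (u a)).
- exact: linear_comp (hmul_linearr (u a)) (hmul_linearl z).
apply: (linear_ext (f := fun z => hmul (u a) (hmul (u b) z))
  (g := hmul (hmul (u a) (u b)))) => [||c].
- exact: linear_comp (hmul_linearr (u b)) (hmul_linearr (u a)).
- exact: hmul_linearr.
exact: assoc_u.
Qed.

Lemma hall_polynomial0l Q (b l : isoclass Q) : F [fsfun] b l = (l == b)%:R.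
Proof.
apply: poly_eq_finfield => K; rewrite (hall_polynomialE K (F_hall _ _ _)).
rewrite hall_number_zero_quot => [|t]; last by rewrite mod_of_dim dimvec0.
rewrite (_ : `[<_>] = (l == b)) ?hornerMn ?hornerC; first by case: eqP.
by apply/asboolP/eqP => [/mod_of_inj //|->]; exact: isomorphic_refl.
Qed.

Lemma hall_polynomial0r Q (a l : isoclass Q) : F a [fsfun] l = (l == a)%:R.
Proof.
apply: poly_eq_finfield => K; rewrite (hall_polynomialE K (F_hall _ _ _)).
rewrite hall_number_zero_sub => [|t]; last by rewrite mod_of_dim dimvec0.
rewrite (_ : `[<_>] = (l == a)) ?hornerMn ?hornerC; first by case: eqP.
by apply/asboolP/eqP => [/mod_of_inj //|->]; exact: isomorphic_refl.
Qed.

Lemma hmul1l Q : left_id (hone Q) hmul.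
Proof.
apply: (linear_ext (f := hmul (hone Q)) (g := id)) => // [|b].
  exact: hmul_linearr.
rewrite hmul_u (@umulE _ _ _ [:: b]) // => [|l].
  rewrite big_seq1 /Defs.hcoef euler0l hall_polynomial0l eqxx rmorph1 hornerC.
  by rewrite mulr1 scale1r.
rewrite inE; apply: contraNT => lb.
by rewrite /Defs.hcoef hall_polynomial0l (negbTE lb) rmorph0 horner0 mulr0.
Qed.

Lemma hmul1r Q : right_id (hone Q) hmul.
Proof.
apply: (linear_ext (f := hmul^~ (hone Q)) (g := id)) => // [|a].
  exact: hmul_linearl.
rewrite hmul_u (@umulE _ _ _ [:: a]) // => [|l].
  rewrite big_seq1 /Defs.hcoef euler0r hall_polynomial0r eqxx rmorph1 hornerC.
  by rewrite mulr1 scale1r.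
rewrite inE; apply: contraNT => la.
by rewrite /Defs.hcoef hall_polynomial0r (negbTE la) rmorph0 horner0 mulr0.
Qed.

Lemma hall_algebra Q : is_algebra (hmul : Hrs Q -> Hrs Q -> Hrs Q) (hone Q).
Proof.
split; [exact: hmul_linearl | exact: hmul_linearr | exact: hmulA | |].
  exact: hmul1l.
exact: hmul1r.
Qed.

(** * Inclusions between the algebras *)

Section Inclusion.
Variables Q Q' : quiver.
Hypothesis sub : forall t, vertex Q t -> vertex Q' t.

Lemma incl_linear : linear (@incl Q Q').
Proof. exact: fglift_linear. Qed.

Lemma incl_u a : incl Q' (u a : Hrs Q) = u (extend Q' a).
Proof. exact: fgliftU. Qed.

Lemma hcoef_extend (a b l : isoclass Q) :
  hcoef (extend Q' a) (extend Q' b) (extend Q' l) = hcoef a b l.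
Proof.
rewrite /Defs.hcoef; congr (_ * _.[_]).
  congr (svar ^ (- _)); apply: euler_dimvec; exact: dimvec_extend.
congr map_poly; apply: poly_eq_finfield => K.
by rewrite !(hall_polynomialE K (F_hall _ _ _)) hall_number_extend.
Qed.

Lemma incl_hmul : {morph (incl Q' : Hrs Q -> Hrs Q') : x y / hmul x y >-> hmul x y}.
Proof.
have incl_umul (a b : isoclass Q) :
    incl Q' (umul a b : Hrs Q) = umul (extend Q' a) (extend Q' b).
  rewrite (umulE (extensions_uniq a b)); last by move=> l /hcoef_dimvec/mem_extensions.
  rewrite (linear_sumZ _ _ _ incl_linear).
  rewrite (@umulE _ _ _ [seq extend Q' l | l <- extensions a b]).
  - by rewrite big_map; apply: eq_bigr => l _; rewrite hcoef_extend incl_u.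
  - by rewrite map_inj_uniq ?extensions_uniq //; exact: extend_inj.
  - move=> l /hcoef_dimvec lE.
    (* Dimension vectors add, so the middle term lives on vertices of [Q] and is the extension of
       its own restriction: the product acquires no terms outside the image. *)
    have lQ : extend Q' (extend Q l) = l.
      apply: extendK => t; rewrite lE !dimvec_extend // addn_eq0 negb_and.
      by case/orP; exact: dimvec_neq0_vertex.
    apply/mapP; exists (extend Q l) => //.
    apply/mem_extensions => t; rewrite -(dimvec_extend sub) lQ lE.
    by rewrite !dimvec_extend.
move=> x y.
apply: (linear_ext (f := fun x => incl Q' (hmul x y))
  (g := fun x => hmul (incl Q' x) (incl Q' y))) => [||a].
- exact: linear_comp (hmul_linearl y) incl_linear.
- exact: linear_comp incl_linear (hmul_linearl (incl Q' y)).
apply: (linear_ext (f := fun y => incl Q' (hmul (u a) y))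
  (g := fun y => hmul (incl Q' (u a)) (incl Q' y))) => [||b].
- exact: linear_comp (hmul_linearr (u a)) incl_linear.
- exact: linear_comp incl_linear (hmul_linearr (incl Q' (u a))).
by rewrite !incl_u !hmul_u incl_umul.
Qed.

Lemma incl_alg_hom :
  is_alg_hom (hmul : Hrs Q -> _ -> _) (hone Q) (hmul : Hrs Q' -> _ -> _) (hone Q')
    (@incl Q Q').
Proof.
split; [exact: incl_linear | exact: incl_hmul |].
by rewrite /hone incl_u extend0.
Qed.

Lemma incl_inj : injective (@incl Q Q').
Proof.
have coeff_incl z : (fun x : Hrs Q => coeff (extend Q' z) (incl Q' x) : Qrs^o) =1
    coeff z.
  apply: linear_ext => [||a].
  - exact: linear_comp incl_linear (coeff_linear (extend Q' z)).
  - exact: coeff_linear.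
  - by rewrite incl_u !coeffU (inj_eq (extend_inj sub)).
move=> x y xy; apply/eqP/freeg_eqP => z.
by rewrite -!coeff_incl xy.
Qed.

End Inclusion.

(** The condition says that common roots of [Q] and [Q''] are roots of [Q']. It covers successive
    inclusions as well as a detour through a larger quiver followed by restriction. *)
Lemma extend_extend Q Q' Q'' (a : isoclass Q) :
  (forall t, vertex Q t -> vertex Q'' t -> vertex Q' t) ->
  extend Q'' (extend Q' a) = extend Q'' a.
Proof.
move=> sub; apply/fsfunP => c; rewrite !extendE.
case: (insubP (proot Q' : subType _) (val c)) => [d _ dE|cQ'] /=.
  by rewrite extendE dE.
case: insubP => //= d /andP[/andP[d1 d2] d12] _.
have /andP[/andP[c1 c2] _] := valP c.
by rewrite !sub // d12 in cQ'.
Qed.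

Lemma incl_incl Q Q' Q'' (x : Hrs Q) :
  (forall t, vertex Q t -> vertex Q'' t -> vertex Q' t) ->
  incl Q'' (incl Q' x) = incl Q'' x.
Proof.
move=> sub; move: x; apply: (linear_ext (f := fun x => incl Q'' (incl Q' x))) => [||a].
- by apply: linear_comp; exact: incl_linear.
- exact: incl_linear.
- by rewrite !incl_u extend_extend.
Qed.

Lemma sub_An_Ainf n t : vertex (An n) t -> vertex Ainf t.
Proof. by case/andP => t0 _; rewrite /vertex t0. Qed.

Lemma sub_An_An n m t : (n <= m)%N -> vertex (An n) t -> vertex (An m) t.
Proof. by move=> nm /andP[t0 tn]; rewrite /vertex t0 (leq_trans tn). Qed.

(** * The universal property of the direct limit *)

Definition supported n (a : isoclass Ainf) : Prop :=
  forall t, (n < t)%N -> dimvec a t = 0%N.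

Lemma supported_vertex n a t : supported n a -> dimvec a t != 0%N -> vertex (An n) t.
Proof.
move=> an at0; rewrite /vertex; have /andP[-> _] := dimvec_neq0_vertex at0.
by rewrite leqNgt; apply: contraNN at0 => /an ->.
Qed.

Lemma supported_exists a : exists n, (0 < n)%N /\ supported n a.
Proof.
have [N aN] := dimvec_finite a; exists N.+1; split=> // t /ltnW tN.
by apply: aN; apply: ltnW.
Qed.

Lemma supportedW n m a : (n <= m)%N -> supported n a -> supported m a.
Proof. by move=> nm an t mt; apply: an; apply: leq_ltn_trans mt. Qed.

Lemma u_supported n a : supported n a -> u a = incl Ainf (u (extend (An n) a)).
Proof.
move=> an; rewrite incl_u extendK // => t; exact: supported_vertex.
Qed.

Section DirectLimit.
Variables (B : lmodType Qrs) (mulB : B -> B -> B) (oneB : B).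
Variable f : forall n : nat, Hrs (An n) -> B.
Hypothesis B_alg : is_algebra mulB oneB.
Hypothesis f_hom : forall n : nat, (0 < n)%N ->
  is_alg_hom (hmul : Hrs (An n) -> _ -> _) (hone (An n)) mulB oneB (@f n).
Hypothesis f_compat : forall n m : nat, (0 < n)%N -> (n <= m)%N ->
  forall x : Hrs (An n), f (incl (An m) x) = f x.

Let level a : nat := sval (cid (supported_exists a)).

(** Each basis element is sent through an arbitrarily chosen level supporting it; compatibility of
    the maps [f] makes the value independent of the level. *)
Definition limit_map : Hrs Ainf -> B :=
  fglift (fun a => f (u (extend (An (level a)) a))).

Lemma limit_map_linear : linear limit_map.
Proof. exact: fglift_linear. Qed.

Lemma limit_map_u n a : (0 < n)%N -> supported n a ->
  limit_map (u a) = f (u (extend (An n) a)).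
Proof.
move=> n0 an; rewrite /limit_map fgliftU /level.
case: cid => m [m0 am] /=.
have f_eq i j : (0 < i)%N -> (i <= j)%N -> supported i a ->
    f (u (extend (An i) a)) = f (u (extend (An j) a)).
  move=> i0 ij ai; rewrite -(f_compat i0 ij) incl_u; congr (f (u _)).
  have {2}-> : a = extend Ainf (extend (An i) a).
    by rewrite extendK // => t; exact: supported_vertex.
  by rewrite [RHS]extend_extend // => t _; exact: sub_An_Ainf.
have [nm|/ltnW mn] := leqP n m; last by apply: f_eq.
by apply/esym/f_eq.
Qed.

Lemma limit_map_incl n (x : Hrs (An n)) : (0 < n)%N ->
  limit_map (incl Ainf x) = f x.
Proof.
move=> n0; have [f_lin _ _] := f_hom n0; move: x.
apply: (linear_ext (f := fun x => limit_map (incl Ainf x)) (g := @f n)) => [||a].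
- exact: linear_comp (@incl_linear _ _) limit_map_linear.
- exact: f_lin.
rewrite incl_u (limit_map_u n0).
  rewrite extendK // => t /dimvec_neq0_vertex; exact: sub_An_Ainf.
move=> t nt; rewrite (dimvec_extend (@sub_An_Ainf n)) dimvec_vertex //.
by rewrite /vertex negb_and -(ltnNge n) nt orbT.
Qed.

Lemma limit_map_hom :
  is_alg_hom (hmul : Hrs Ainf -> _ -> _) (hone Ainf) mulB oneB limit_map.
Proof.
have [B_linl B_linr _ _ _] := B_alg.
split; [exact: limit_map_linear | | ]; last first.
  have [_ _ <-] := f_hom (ltn0Sn 0).
  by rewrite -(limit_map_incl (hone (An 1))) // /hone incl_u extend0.
move=> x y.
apply: (linear_ext (f := fun x => limit_map (hmul x y))
  (g := fun x => mulB (limit_map x) (limit_map y))) => [||a].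
- exact: linear_comp (hmul_linearl y) limit_map_linear.
- exact: linear_comp limit_map_linear (B_linl (limit_map y)).
apply: (linear_ext (f := fun y => limit_map (hmul (u a) y))
  (g := fun y => mulB (limit_map (u a)) (limit_map y))) => [||b].
- exact: linear_comp (hmul_linearr (u a)) limit_map_linear.
- exact: linear_comp limit_map_linear (B_linr (limit_map (u a))).
have [i [i0 ai]] := supported_exists a; have [j [j0 bj]] := supported_exists b.
(* At a common level both factors and their product come from one algebra, where [f n] is
   multiplicative. *)
pose n := maxn i j; have n0 : (0 < n)%N by rewrite leq_max i0.
have an : supported n a by apply: supportedW ai; exact: leq_maxl.
have bn : supported n b by apply: supportedW bj; exact: leq_maxr.
have [_ f_mul _] := f_hom n0.
have E : hmul (u a) (u b)
    = incl Ainf (hmul (u (extend (An n) a)) (u (extend (An n) b))).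
  apply: etrans (esym (incl_hmul (@sub_An_Ainf n) _ _)).
  exact: f_equal2 (u_supported an) (u_supported bn).
transitivity (f (hmul (u (extend (An n) a)) (u (extend (An n) b)))).
  cbv beta; apply: (etrans (congr1 limit_map E)).
  exact: limit_map_incl.
apply: etrans (f_mul _ _) _.
exact: f_equal2 (esym (limit_map_u n0 an)) (esym (limit_map_u n0 bn)).
Qed.

Lemma limit_map_unique (g : Hrs Ainf -> B) : linear g ->
  (forall n, (0 < n)%N -> forall x : Hrs (An n), g (incl Ainf x) = f x) ->
  limit_map = g.
Proof.
move=> g_lin g_incl; apply: funext; apply: linear_ext => [||a].
- exact: limit_map_linear.
- exact: g_lin.
have [n [n0 an]] := supported_exists a.
by rewrite -/(u a) (u_supported an) g_incl // limit_map_incl.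
Qed.

End DirectLimit.

End HallAlgebra.

Theorem theorem2p3 (k : fieldType)
    (F : forall Q : quiver,
       isoclass Q -> isoclass Q -> isoclass Q -> {poly int})
    (F_hall : forall (Q : quiver) (a b l : isoclass Q),
       hall_polynomial a b l (F Q a b l)) :
  let mul (Q : quiver) : Hrs Q -> Hrs Q -> Hrs Q := hmul k (F Q) in
  let alg_hom (Q Q' : quiver) : (Hrs Q -> Hrs Q') -> Prop :=
    is_alg_hom (mul Q) (hone Q) (mul Q') (hone Q') in
  (* the sums defining the products are finite, in H(A_infinity) and H(A_n) *)
  [/\ forall (Q : quiver) (a b : isoclass Q),
        finite_set [set l | hcoef k (F Q) a b l != 0],
      is_algebra (mul Ainf) (hone Ainf),
      forall n : nat, (0 < n)%N -> is_algebra (mul (An n)) (hone (An n)),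
      forall n m : nat, (0 < n)%N -> (n <= m)%N ->
        [/\ alg_hom (An n) Ainf (@incl (An n) Ainf),
            injective (@incl (An n) Ainf),
            alg_hom (An n) (An m) (@incl (An n) (An m)) &
            injective (@incl (An n) (An m))]
  (* H(A_infinity) is the direct limit, in the category of Q(r,s)-algebras *)
    & (forall n m : nat, (0 < n)%N -> (n <= m)%N ->
         forall x : Hrs (An n),
           @incl (An m) Ainf (@incl (An n) (An m) x) = @incl (An n) Ainf x) /\
      (forall (B : lmodType Qrs) (mulB : B -> B -> B) (oneB : B)
         (f : forall n : nat, Hrs (An n) -> B),
         is_algebra mulB oneB ->
         (forall n : nat, (0 < n)%N ->
            is_alg_hom (mul (An n)) (hone (An n)) mulB oneB (f n)) ->
         (forall n m : nat, (0 < n)%N -> (n <= m)%N ->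
            forall x : Hrs (An n), f m (@incl (An n) (An m) x) = f n x) ->
         exists! g : Hrs Ainf -> B,
           is_alg_hom (mul Ainf) (hone Ainf) mulB oneB g /\
           forall n : nat, (0 < n)%N ->
             forall x : Hrs (An n), g (@incl (An n) Ainf x) = f n x)].
Proof.
move=> mul alg_hom; split.
- move=> Q a b; apply: sub_finite_set (finite_extensions a b) => l /=.
  exact: (hcoef_dimvec F_hall).
- exact: (hall_algebra k F_hall Ainf).
- by move=> n _; exact: (hall_algebra k F_hall (An n)).
- move=> n m _ nm; split.
  + exact: (incl_alg_hom k F_hall (@sub_An_Ainf n)).
  + exact: (incl_inj (@sub_An_Ainf n)).
  + exact: (incl_alg_hom k F_hall (fun t => @sub_An_An n m t nm)).
  + exact: (incl_inj (fun t => @sub_An_An n m t nm)).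
- split=> [n m _ nm x|B mulB oneB f B_alg f_hom f_compat].
    by apply: incl_incl => t tn _; exact: (sub_An_An nm tn).
  exists (limit_map f); split=> [|g [[g_lin _ _] g_incl]].
    split; first exact: (limit_map_hom F_hall B_alg f_hom f_compat).
    move=> n n0 x; exact: (limit_map_incl f_hom f_compat x n0).
  exact: (limit_map_unique f_hom f_compat g_lin g_incl).
Qed.
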